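(* Let $B$ be a $2$-dimensional focus box and let $C$ be a closed connected subset of $B$ which is strongly locally convex in $B$. Then $C$ is convex. If, moreover, $C$ contains the focus point of $B$, then $C$ is strongly convex in $B$.
   Context: Focus box. A singular affine surface is a smooth surface with a sheaf of smooth functions (local affine functions, stable under real linear combinations and containing the constants) such that near each point of an open dense set (the regular points) two affine functions with independent differentials form local coordinates and, together with constants, span the affine functions; the non-regular points are focus points. A 2-dimensional focus box $B$ (of any size, not necessarily small) is a compact region with exactly one focus point $O$, on the whole of which there is a multi-valued affine coordinate system $(F,G)$ centred at $O$, i.e.: a single-valued affine function $F$, a smooth function $H$ such that $(F,H)$ are smooth coordinates with $O=\{F=H=0\}$, and two continuous functions $G_l,G_r$ with $G_l$ affine on $B\setminus\{F=0,H\ge0\}$, $G_r$ affine on $B\setminus\{F=0,H\le0\}$, $G_l=G_r=:G$ when $F\le0$, $G_r=G_l+kF$ when $F\ge0$ for a constant $k>0$ (the index), $\partial G_l/\partial H=\partial G_r/\partial H>0$ away from $O$, and $F(O)=G(O)=0$; and $$B=\{x: F(x)\in[-\delta,\delta],\ G_l(x),G_r(x)\in[-\delta',\delta']\}$$ for some $\delta,\delta'>0$. (It is a convex quadrilateral if $2\delta'>k\delta$.) Straight lines. A regular straight line is a curve (continuous map from an interval) in the regular part that is affine in every local affine chart. A singular straight line is a non-constant parametrized continuous curve $\gamma:I\to B$ containing focus points such that every $t_0$ in the interior of $I$ has a neighborhood $[s,t]\subset I$ on which $\gamma$ is a (uniform) limit of affinely parametrized regular straight lines $\gamma_n:[s,t]\to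 B$. A straight line is a regular or a singular straight line. There may be more than one straight line joining two given points. Convexity. $C\subset B$ is convex if any two points of $C$ can be joined by at least one straight line contained in $C$. $C$ is strongly convex in $B$ if $C$ is convex and, moreover, for any two distinct points of $C$, every straight line in $B$ joining them lies in $C$. $C$ is strongly locally convex in $B$ if any neighborhood $U$ of any point $x\in C$ contains a sub-neighborhood $V$ of $x$ such that $C\cap V$ is strongly convex in $V$ (any two distinct points of $C\cap V$ are joined by a straight line in $C\cap V$, and every straight line in $V$ joining them lies in $C$). *)

(* Defs.v *)
From HB Require Import structures.
From mathcomp Require Export all_boot all_order all_algebra.
From mathcomp Require Export all_classical all_reals all_analysis.

Set Implicit Arguments.
Unset Strict Implicit.
Unset Printing Implicit Defensive.

Export Order.TTheory GRing.Theory Num.Theory.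
Export numFieldNormedType.Exports.

Local Open Scope classical_set_scope.
Local Open Scope ring_scope.

Section SmoothSurfaces.
Context {R : realType}.
Implicit Types (D : set (R * R)) (f : R * R -> R).

Fixpoint Ck (k : nat) D f : Prop :=
  (forall p, D p -> {for p, continuous f}) /\
  match k with
  | 0%N => True
  | k'.+1 =>
      [/\ forall p, D p -> derivable f p (1, 0) /\ derivable f p (0, 1),
          Ck k' D (fun p => 'D_(1, 0) f p) &
          Ck k' D (fun p => 'D_(0, 1) f p)]
  end.

(* The domain D is open in all uses. *)
Definition smooth_plane D f : Prop := forall k, Ck k D f.

(* Surfaces are Hausdorff and second countable, hence metrizable.  The metric
   on M is auxiliary: it is only used to speak of uniform limits of curves in a
   compact set, which do not depend on the choice of a compatible metric. *)
Variable M : metricType R.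
Implicit Types (U V : set M) (h : M -> R).

Record chart := Chart {
  chart_dom : set M;
  chart_map :> M -> R * R;
  chart_inv : R * R -> M;
  chart_dom_open : open chart_dom;
  chart_im_open : open (chart_map @` chart_dom);
  chart_invK : forall x, chart_dom x -> chart_inv (chart_map x) = x;
  chart_map_continuous :
    forall x, chart_dom x -> {for x, continuous chart_map};
  chart_inv_continuous :
    forall p, (chart_map @` chart_dom) p -> {for p, continuous chart_inv} }.

Definition smooth_transition (c c' : chart) : Prop :=
  let D := c @` (chart_dom c `&` chart_dom c') in
  smooth_plane D (fun p => (c' (chart_inv c p)).1) /\
  smooth_plane D (fun p => (c' (chart_inv c p)).2).

Definition compatible (c c' : chart) : Prop :=
  smooth_transition c c' /\ smooth_transition c' c.

Record smooth_surface := SmoothSurface {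
  atlas : set chart;
  atlas_cover : forall x : M, exists2 c, atlas c & chart_dom c x;
  atlas_compatible : forall c c', atlas c -> atlas c' -> compatible c c';
  surface_second_countable : @second_countable M }.

(* c belongs to the maximal atlas of S *)
Definition smooth_coordinates (S : smooth_surface) (c : chart) : Prop :=
  forall c', atlas S c' -> compatible c c'.

Definition smooth_on (S : smooth_surface) U h : Prop :=
  forall c, atlas S c ->
    smooth_plane (c @` (chart_dom c `&` U)) (h \o chart_inv c).

(* Sections over an open set U are represented by total functions, of which
   only the values on U matter. *)
Record affine_sheaf (S : smooth_surface) := AffineSheaf {
  aff : set M -> (M -> R) -> Prop;
  aff_smooth : forall U h, open U -> aff U h -> smooth_on S U h;
  aff_ext : forall U h h', open U ->
    (forall x, U x -> h x = h' x) -> aff U h -> aff U h';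
  aff_restrict : forall U V h, open U -> open V -> V `<=` U ->
    aff U h -> aff V h;
  aff_glue : forall U h, open U ->
    (forall x, U x -> exists V, [/\ open V, V x, V `<=` U & aff V h]) ->
    aff U h;
  aff_cst : forall U (a : R), open U -> aff U (fun=> a);
  aff_lin : forall U (a b : R) h h', open U -> aff U h -> aff U h' ->
    aff U (fun x => a * h x + b * h' x) }.

(* The two components of c automatically have independent differentials, as c
   is a diffeomorphism onto an open subset of the plane. *)
Definition affine_chart (S : smooth_surface) (A : affine_sheaf S)
    (c : chart) : Prop :=
  [/\ smooth_coordinates S c,
      aff A (chart_dom c) (fun x => (c x).1),
      aff A (chart_dom c) (fun x => (c x).2) &
      forall V h, open V -> V `<=` chart_dom c -> aff A V h ->
        forall y, V y -> exists a b1 b2 : R,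
          \forall z \near y, h z = a + b1 * (c z).1 + b2 * (c z).2].

Definition regular_points (S : smooth_surface) (A : affine_sheaf S) : set M :=
  [set x | exists2 c, affine_chart A c & chart_dom c x].

Record singular_affine_surface := SingularAffineSurface {
  sas_surface :> smooth_surface;
  sas_sheaf : affine_sheaf sas_surface;
  regular_points_dense : dense (regular_points sas_sheaf) }.

End SmoothSurfaces.

Arguments singular_affine_surface {R} M.

Section StraightLines.
Context {R : realType} {M : metricType R}.
Variable S : singular_affine_surface M.
Implicit Types (B C U V : set M) (I : set R) (g : R -> M) (c : chart M).

Definition regular : set M := regular_points (sas_sheaf S).
Definition focus : set M := ~` regular.

Definition regular_line I g : Prop :=
  [/\ is_interval I,
      {within I, continuous g},
      g @` I `<=` regular &
      forall c, affine_chart (sas_sheaf S) c ->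
        forall s t : R, s <= t -> `[s, t] `<=` I ->
          g @` `[s, t] `<=` chart_dom c ->
          exists p v : R * R, forall u, s <= u <= t -> c (g u) = p + u *: v].

Definition singular_line B I g : Prop :=
  [/\ is_interval I,
      {within I, continuous g} /\ g @` I `<=` B,
      exists t t', [/\ I t, I t' & g t <> g t'],
      exists2 t, I t & focus (g t) &
      forall t0, interior I t0 ->
        exists s t : R, [/\ s < t0 < t, `[s, t] `<=` I &
          exists g_ : nat -> R -> M,
            (forall n, regular_line `[s, t] (g_ n) /\
                       g_ n @` `[s, t] `<=` B) /\
            {uniform `[s, t], g_ @ \oo --> g}]].

Definition straight_line B I g : Prop :=
  (regular_line I g /\ g @` I `<=` B) \/ singular_line B I g.

Definition line_joining B (x y : M) (a b : R) g : Prop :=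
  [/\ a < b, straight_line B `[a, b] g, g a = x & g b = y].

(* The two points are required to be distinct: a focus point cannot be joined
   to itself, singular lines being non-constant. *)
Definition convex_in B C : Prop :=
  C `<=` B /\
  forall x y, C x -> C y -> x <> y ->
    exists a b g, line_joining B x y a b g /\ g @` `[a, b] `<=` C.

(* For V included in B, the straight lines in V are the straight lines of B
   which lie in V. *)
Definition strongly_convex_in B V C : Prop :=
  convex_in B C /\ C `<=` V /\
  forall x y, C x -> C y -> x <> y ->
    forall a b g, line_joining B x y a b g ->
      g @` `[a, b] `<=` V -> g @` `[a, b] `<=` C.

Definition strongly_locally_convex B C : Prop :=
  forall x, C x -> forall U, within B (nbhs x) U ->
    exists V, [/\ V `<=` U `&` B, within B (nbhs x) V &
                  strongly_convex_in B V (C `&` V)].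

(* c = (F, H) is defined on an open set containing the box; Gl and Gr are the
   two branches of G, of index k. *)
Record multivalued_coordinates (O : M) c (Gl Gr : M -> R) (k : R) : Prop :=
 MultivaluedCoordinates {
  mc_smooth : smooth_coordinates S c;
  mc_F_affine : aff (sas_sheaf S) (chart_dom c) (fun x => (c x).1);
  mc_dom_O : chart_dom c O;
  mc_O : c O = (0, 0);
  mc_Gl_continuous : forall x, chart_dom c x -> {for x, continuous Gl};
  mc_Gr_continuous : forall x, chart_dom c x -> {for x, continuous Gr};
  mc_Gl_affine : aff (sas_sheaf S)
    (chart_dom c `\` [set x | (c x).1 = 0 /\ 0 <= (c x).2]) Gl;
  mc_Gr_affine : aff (sas_sheaf S)
    (chart_dom c `\` [set x | (c x).1 = 0 /\ (c x).2 <= 0]) Gr;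
  mc_index : 0 < k;
  mc_left : forall x, chart_dom c x -> (c x).1 <= 0 -> Gl x = Gr x;
  mc_right : forall x, chart_dom c x -> 0 <= (c x).1 ->
    Gr x = Gl x + k * (c x).1;
  mc_dH : forall x, chart_dom c x -> x <> O ->
    let gl := Gl \o chart_inv c in
    let gr := Gr \o chart_inv c in
    [/\ derivable gl (c x) (0, 1), derivable gr (c x) (0, 1),
        'D_(0, 1) gl (c x) = 'D_(0, 1) gr (c x) &
        0 < 'D_(0, 1) gl (c x)];
  mc_Gl_O : Gl O = 0;
  mc_Gr_O : Gr O = 0 }.

Definition focus_box (O : M) B : Prop :=
  [/\ compact B, connected B, B `&` focus = [set O] &
      exists c (Gl Gr : M -> R) (k d d' : R),
        [/\ multivalued_coordinates O c Gl Gr k, 0 < d, 0 < d' &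
            B = [set x | [/\ chart_dom c x, - d <= (c x).1 <= d,
                             - d' <= Gl x <= d' & - d' <= Gr x <= d']]]].

End StraightLines.

(* Main.v *)
(** In the coordinates (F, Gl) and (F, Gr) the straight lines of the box are
    segments: a line crossing F = 0 above O is a segment for (F, Gr), a line
    crossing F = 0 below O is a segment for (F, Gl), and both kinds pass through
    O.  The Gr-segment joining two points crosses F = 0 above the Gl-segment, so
    at least one of the two is a straight line.

    Let X be a compact connected planar set whose nearby points are joined in X
    by curves transverse to the vertical direction.  Then the vertical slices of
    X are connected: two such curves with a common point sweep out a region of
    X, as the set of abscissae where the vertical segment between them lies in X
    is open and closed.  Applied to the box this makes (F, Gl) injective on it;
    applied to C this makes the fibres of F on C connected; applied to the
    linear images of a set it gives the Tietze-Nakajima theorem.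

    If O is not in C, the fibre of C over F = 0 is on one side of O, and C is
    locally convex for the corresponding coordinates.  If O is in C, then C is
    locally convex for both: when the segment of one kind is not a straight line,
    its crossing point with F = 0 lies between O and the crossing point of the
    segment of the other kind, which is in C.  The Tietze-Nakajima theorem makes
    local convexity global. *)

Require Import Defs.
From mathcomp Require Import ring lra.

Set Implicit Arguments.
Unset Strict Implicit.
Unset Printing Implicit Defensive.

Local Open Scope classical_set_scope.
Local Open Scope ring_scope.

(** * Topological preliminaries *)

(** The box is not assumed small, and the sign of the H-derivative makes Gl increasing only along
    verticals contained in the chart domain. So neither injectivity of (F, Gl) nor an identification
    of the box with a planar region is available at the start. Connected slices give injectivity, a
    continuity argument along rays from O gives the exact image, which is convex, and compactness
    makes the inverse uniformly continuous. That a whole straight line is affine in a single branch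
    rests on Gr - Gl = k F^+: along a line F is affine, so F^+ is affine near every time at which F
    does not vanish, both branches are then equally good, and only the crossing time selects one.
    For limits of lines, failure to be affine in a given branch is an open condition, so the other
    branch serves for all late terms. A segment of a fixed branch need not be a straight line. Hence
    local convexity is stated for segments of a branch, globalized in the plane, and only afterwards
    is a segment recognized as a straight line. *)

Lemma connected_locally_constant (T : topologicalType) (A : set T) (P : T -> Prop)
    (x0 : T) :
  connected A -> A x0 -> P x0 ->
  (forall x, A x -> P x -> \forall y \near x, A y -> P y) ->
  (forall x, A x -> ~ P x -> \forall y \near x, A y -> ~ P y) ->
  A `<=` P.
Proof.
move=> cA Ax0 Px0 oP oNP.
have opn (Q : T -> Prop) :
    (forall x, A x -> Q x -> \forall y \near x, A y -> Q y) ->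
    exists2 U, open U & A `&` [set x | Q x] = A `&` U.
  move=> h; exists ([set x | A x -> Q x]^°); first exact: open_interior.
  apply/seteqP; split=> x [Ax]; last by move=> /interior_subset /(_ Ax).
  by move=> Qx; split => //; exact: h.
have [U oU eU] := opn _ oP; have [V oV eV] := opn _ oNP.
suff -> : A = A `&` [set x | P x] by move=> x [].
symmetry; apply: cA; first by exists x0.
  by exists U.
exists (~` V); first exact: open_closedC.
apply/seteqP; split=> x [Ax].
  move=> Px; split=> // Vx.
  by have : (A `&` V) x by []; rewrite -eV => -[].
move=> nVx; split => //; apply: contrapT => nPx; apply: nVx.
by have : (A `&` [set x | ~ P x]) x by []; rewrite eV => -[].
Qed.

(** Around a point with [f x > 0], [f] stays above [f x / 2], so small thresholds exclude it; around
    the others [P] holds on [K]. Compactness makes the threshold uniform. It is applied with [f] a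
    distance to a vertical slice, or a distance in coordinates between two points. *)
Lemma compact_near_zero {R : realType} (T : topologicalType) (K : set T)
    (f : T -> R) (P : T -> Prop) :
  compact K -> (forall x, K x -> {for x, continuous f}) ->
  (forall x, K x -> f x <= 0 -> \forall y \near x, K y -> P y) ->
  exists2 e : R, 0 < e & forall x, K x -> f x < e -> P x.
Proof.
move=> /compact_near_coveringP cK fc fP.
have [e /= e0 eP] : \forall e \near 0^'+, K `<=` [set x | K x -> f x < e -> P x].
  apply: cK => x Kx; have [fx0|fx0] := leP (f x) 0.
    have h := fP _ Kx fx0; near=> y e => Ky _.
    have hy : K y -> P y by near: y.
    exact: hy.
  have : \forall y \near x, f x / 2 < f y.
    apply: (cvgr_gt (f x)); [exact: fc|lra].
  move=> h; near=> y e => _ /= fe; exfalso.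
  have : f x / 2 < f y by near: y.
  have : e < f x / 2 by near: e; apply: nbhs_right_lt; lra.
  lra.
exists (e / 2); first lra.
move=> x Kx fx; apply: (eP (e / 2)) => //=; last lra.
rewrite sub0r normrN ger0_norm; lra.
Unshelve. all: by end_near.
Qed.

Section Continuity.
Context {R : realType} {T : topologicalType}.
Implicit Types (f g : T -> R) (h : T -> R * R) (x : T).

Lemma ctsD f g x : {for x, continuous f} -> {for x, continuous g} ->
  {for x, continuous (fun u => f u + g u)}.
Proof. exact: continuousD. Qed.

Lemma ctsN f x : {for x, continuous f} -> {for x, continuous (fun u => - f u)}.
Proof. exact: continuousN. Qed.

Lemma ctsM f g x : {for x, continuous f} -> {for x, continuous g} ->
  {for x, continuous (fun u => f u * g u)}.
Proof. exact: continuousM. Qed.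

Lemma cts_norm f x : {for x, continuous f} ->
  {for x, continuous (fun u => `|f u|)}.
Proof. by move=> fx; apply: (@continuous_comp _ _ _ f) => //;
  exact: norm_continuous. Qed.

Lemma cts_pair (U V : topologicalType) (f : T -> U) (g : T -> V) x :
  {for x, continuous f} -> {for x, continuous g} ->
  {for x, continuous (fun u => (f u, g u))}.
Proof. by move=> fx gx; exact: (cvg_pair fx gx). Qed.

Lemma cts_fst (U V : topologicalType) (h : T -> U * V) x :
  {for x, continuous h} -> {for x, continuous (fun u => (h u).1)}.
Proof. by move=> hx; apply: (@continuous_comp _ _ _ h) => //; exact: cvg_fst. Qed.

Lemma cts_snd (U V : topologicalType) (h : T -> U * V) x :
  {for x, continuous h} -> {for x, continuous (fun u => (h u).2)}.
Proof. by move=> hx; apply: (@continuous_comp _ _ _ h) => //; exact: cvg_snd. Qed.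

Lemma cts_id x : {for x, continuous (fun u : T => u)}.
Proof. by move=> ?; exact. Qed.

Lemma cts_cst (U : topologicalType) (a : U) x :
  {for x, continuous (fun=> a : U)}.
Proof. exact: cst_continuous. Qed.

Lemma within_cts (U : topologicalType) (A : set T) (f : T -> U) :
  (forall x, A x -> {for x, continuous f}) -> {within A, continuous f}.
Proof. by move=> fc; apply: continuous_in_subspaceT => x /set_mem; exact: fc. Qed.

Lemma closed_le_cts f g : (forall x, {for x, continuous f}) ->
  (forall x, {for x, continuous g}) -> closed [set x | f x <= g x].
Proof.
move=> fc gc.
have -> : [set x | f x <= g x] = (fun x => g x - f x) @^-1` [set y | 0 <= y].
  by apply/seteqP; split=> x /=; rewrite subr_ge0.
apply: preimage_closed; last exact: closed_ge.
by move=> x _; apply: ctsD => //; apply: ctsN.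
Qed.

Lemma closed_eq_cts f g : (forall x, {for x, continuous f}) ->
  (forall x, {for x, continuous g}) -> closed [set x | f x = g x].
Proof.
move=> fc gc.
have -> : [set x | f x = g x] = [set x | f x <= g x] `&` [set x | g x <= f x].
  apply/seteqP; split=> x /=; first by move=> ->.
  by move=> [? ?]; apply/le_anti/andP.
by apply: closedI; exact: closed_le_cts.
Qed.

End Continuity.

Lemma continuous_fst (U V : topologicalType) (x : U * V) :
  {for x, continuous fst}.
Proof. exact: cvg_fst. Qed.

Lemma continuous_snd (U V : topologicalType) (x : U * V) :
  {for x, continuous snd}.
Proof. exact: cvg_snd. Qed.

(* The unapplied patterns are the eta-contracted forms left by apply. *)
Ltac cts := repeat match goal with
  | |- prop_for _ (inPhantom (forall x, continuous_at x ?f)) =>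
    lazymatch f with
    | fun u => u => apply: cts_id
    | GRing.mul _ => apply: mulrl_continuous
    | fst => apply: continuous_fst
    | snd => apply: continuous_snd
    | fun u => Algebra.add _ _ => apply: ctsD
    | fun u => Algebra.opp _ => apply: ctsN
    | fun u => GRing.mul _ _ => apply: ctsM
    | fun u => Num.norm _ => apply: cts_norm
    | fun u => pair _ _ => apply: cts_pair
    | fun u => fst _ => apply: cts_fst
    | fun u => snd _ => apply: cts_snd
    | fun u => ?a => apply: cts_cst
    end
  end.

Lemma near_lt {R : realType} (T : topologicalType) (f : T -> R) (x : T) (a : R) :
  {for x, continuous f} -> f x < a -> \forall y \near x, f y < a.
Proof. by move=> fx; apply: (cvgr_lt (f x)); exact: fx. Qed.

Lemma near_gt {R : realType} (T : topologicalType) (f : T -> R) (x : T) (a : R) :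
  {for x, continuous f} -> a < f x -> \forall y \near x, a < f y.
Proof. by move=> fx; apply: (cvgr_gt (f x)); exact: fx. Qed.

Lemma closed_preimage_cts (T U : topologicalType) (f : T -> U) (D : set U) :
  (forall x, {for x, continuous f}) -> closed D -> closed (f @^-1` D).
Proof. by move=> fc; apply: preimage_closed => x _; exact: fc. Qed.

Lemma within_comp (T T' U' : topologicalType) (I : set T) (g : T -> T')
    (h : T' -> U') : {within I, continuous g} ->
  (forall t, I t -> {for g t, continuous h}) -> {within I, continuous (h \o g)}.
Proof.
move=> /subspace_continuousP gc hc; apply/subspace_continuousP => t It.
by apply: cvg_comp; [exact: gc|exact: hc].
Qed.

Lemma within_near (T T' : topologicalType) (A : set T) (g : T -> T') t W :
  {within A, continuous g} ->
  A t -> nbhs (g t) W -> \forall u \near t, A u -> W (g u).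
Proof. by move=> /subspace_continuousP gc At /(gc t At). Qed.

Lemma compact_level {R : realType} (T : topologicalType) (A : set T)
    (u : T -> R) :
  hausdorff_space T -> compact A -> (forall x, A x -> {for x, continuous u}) ->
  compact (A `&` [set x | u x = 0]).
Proof.
move=> hT cA uc; apply: (subclosed_compact _ cA); last by move=> x [].
move=> x clx; have Ax : A x.
  by apply: (compact_closed hT cA); move=> V /clx [y [[]]]; exists y.
split=> //=; apply: contrapT => ux0.
have : \forall y \near x, 0 < `|u y|.
  apply: near_gt; first by apply: cts_norm; exact: uc.
  by rewrite normr_gt0; apply/eqP.
by move=> /clx [y [[_ /= ->]]]; rewrite normr0 ltxx.
Qed.

Lemma uniform_ballP {R : realType} (M : metricType R) (I : set R)
    (g_ : nat -> R -> M) (g : R -> M) :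
  {uniform I, g_ @ \oo --> g} <-> forall e, 0 < e ->
    \forall n \near \oo, forall t, I t -> ball (g t) e (g_ n t).
Proof.
split=> [gu e e0|gu P /uniform_nbhs[E [+ EP]]]; last first.
  rewrite -entourage_ballE => -[e /= e0 eE]; have ge := gu e e0.
  have : \forall n \near \oo, P (g_ n).
    by apply: filterS ge => n gn; apply: EP => y Iy; apply: eE; exact: gn.
  exact.
have nb : nbhs (g : {uniform` I -> M})
    [set h | forall y, I y -> ball (g y) e (h y)].
  apply/uniform_nbhs; exists [set xy | ball xy.1 e xy.2].
  by split=> //; exact: (entourage_ball _ (PosNum e0)).
exact: gu _ nb.
Qed.

Lemma uniform_cvg_at {R : realType} (M : metricType R) (I : set R)
    (g_ : nat -> R -> M) (g : R -> M) (t : R) :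
  {uniform I, g_ @ \oo --> g} -> I t -> g_ n t @[n --> \oo] --> g t.
Proof.
move=> /uniform_ballP gu It W /= /nbhs_ballP[e /= e0 eW].
have ge := gu e e0.
have : \forall n \near \oo, W (g_ n t).
  by apply: filterS ge => n gn; apply: eW; exact: gn.
exact.
Qed.

(** * Connectedness of vertical slices *)

Section Strips.
Context {R : realType}.
Implicit Types (K X : set (R * R)).

Lemma itv_convex (a b t : R) : a <= b -> 0 <= t -> t <= 1 ->
  a <= a + t * (b - a) <= b.
Proof.
move=> ab t0 t1; rewrite lerDl mulr_ge0 ?subr_ge0 //=.
by rewrite -lerBrDl ler_piMl ?subr_ge0.
Qed.

Definition vconvex K :=
  forall f a b h, K (f, a) -> K (f, b) -> a <= h <= b -> K (f, h).

Definition vhull K : set (R * R) :=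
  [set z | exists a b, [/\ K (z.1, a), K (z.1, b) & a <= z.2 <= b]].

(* Strips play the role of curves transverse to the vertical direction, with
   the advantage that the vertical hull of two strips may again be a strip. *)
Definition strip X K :=
  [/\ compact K, K `<=` X, is_interval (fst @` K) & vconvex K].

(** The last condition is transversality at [x]: over abscissae close to that of [x], the heights of
    [K] are close to that of [x]. Endpoints on a common vertical are exempt, since there [K]
    contains the interval between them. *)
Definition strip_joined X K x y :=
  [/\ strip X K, K x, K y & x.1 != y.1 -> forall z, K z -> z.1 = x.1 -> z = x].

Definition locally_strip_joined X := forall p, X p ->
  exists2 V, nbhs p V &
    forall x y, X x -> V x -> X y -> V y -> exists K, strip_joined X K x y.

Lemma sub_vhull K : K `<=` vhull K.
Proof. by move=> [f h] Kz; exists h, h; rewrite /= lexx. Qed.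

(** The hull is the continuous image of a compact set: the pairs of points of [K] over a common
    abscissa, with a barycentric parameter. *)
Lemma compact_vhull K : compact K -> compact (vhull K).
Proof.
move=> cK.
pose D := [set u : (R * R) * (R * R) | u.1.1 = u.2.1].
pose m (u : ((R * R) * (R * R)) * R) :=
  (u.1.1.1, u.1.1.2 + u.2 * (u.1.2.2 - u.1.1.2)).
have -> : vhull K = m @` (((K `*` K) `&` D) `*` `[0, 1]).
  apply/seteqP; split=> [[f h] [a [b [/= Ka Kb /andP[ah hb]]]]|z].
    have [ab|ab] := eqVneq a b.
      exists ((f, a), (f, b), 0) => /=.
        by split=> //=; rewrite in_itv /= lexx ler01.
      by rewrite /m /= mul0r addr0; congr pair; apply: le_anti; rewrite ah ab.
    have b_a : 0 < b - a by rewrite subr_gt0 lt_neqAle ab (le_trans ah hb).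
    exists ((f, a), (f, b), (h - a) / (b - a)).
      split=> //=; rewrite in_itv /= divr_ge0 ?(ltW b_a) ?subr_ge0 //=.
      by rewrite ler_pdivrMr // mul1r lerB.
    by rewrite /m /= divfK ?gt_eqF // addrC subrK.
  case=> [[[[f a] [f' b]] t] /= [[[Ka Kb]]]]; rewrite /D /= => ff.
  rewrite -{}ff in Kb *; rewrite in_itv /= => /andP[t0 t1] <-.
  rewrite /m /=; have [ab|ba] := leP a b.
    by exists a, b; split=> //; exact: itv_convex.
  exists b, a; split=> //=.
  have -> : a + t * (b - a) = b + (1 - t) * (a - b) by ring.
  by apply: itv_convex; rewrite ?(ltW ba) // ?subr_ge0 // lerBlDr lerDl.
apply: continuous_compact; first by apply: within_cts => u _; rewrite /m; cts.
apply: compact_setX; last exact: segment_compact.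
apply: compact_closedI; first exact: compact_setX.
by apply: closed_eq_cts => u; cts.
Qed.

Lemma compact_slice K f0 (P : R * R -> Prop) : compact K ->
  (forall z, K z -> z.1 = f0 -> \forall w \near z, K w -> P w) ->
  exists2 e, 0 < e & forall z, K z -> `|z.1 - f0| < e -> P z.
Proof.
move=> cK KP; apply: (compact_near_zero (f := fun z => `|z.1 - f0|) cK).
  by move=> x _; cts.
by move=> x Kx; rewrite normr_le0 subr_eq0 => /eqP; exact: KP.
Qed.

End Strips.

Section Gaps.
Context {R : realType}.
Implicit Types (K X : set (R * R)) (x y : R * R).

Lemma vconvex_vhull K : vconvex (vhull K).
Proof.
move=> f a b h [a1 [a2 [/= K1 K2 /andP[la _]]]] [b1 [b2 [/= K3 K4 /andP[_ lb]]]].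
move=> /andP[ah hb]; exists a1, b2; split=> //=.
by rewrite (le_trans la) // (le_trans hb).
Qed.

(** The ends of a bounded component of the complement of a vertical slice. A closed set is [vconvex]
    exactly when it has no gap. *)
Definition gap X x y := [/\ X x, X y, x.1 = y.1, x.2 < y.2 &
  forall h, x.2 < h < y.2 -> ~ X (x.1, h)].

Lemma closed_last X (f a h : R) : closed X -> X (f, a) -> a <= h ->
  exists2 c, a <= c <= h & X (f, c) /\ forall t, c < t <= h -> ~ X (f, t).
Proof.
move=> cX Xa ah; pose E := [set t | t <= h] `&` [set t | X (f, t)].
have Ea : E a by [].
have ubE : ubound E h by move=> t [].
have cE : closed E.
  apply: closedI; first exact: closed_le.
  by apply: (closed_preimage_cts (f := fun t => (f, t))) => // t; cts.
have [Es1 Es2] : E (sup E).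
  by apply: cE; apply: closure_sup; [exists a|exists h].
exists (sup E).
  by rewrite (ub_le_sup _ Ea) //=; exists h.
split=> // t /andP[ct th] Xt.
suff : t <= sup E by rewrite leNgt ct.
by apply: ub_le_sup; [exists h|split].
Qed.

Lemma closed_first X (f h b : R) : closed X -> X (f, b) -> h <= b ->
  exists2 c, h <= c <= b & X (f, c) /\ forall t, h <= t < c -> ~ X (f, t).
Proof.
move=> cX Xb hb; pose Y := (fun z : R * R => (z.1, - z.2)) @^-1` X.
have [|||c /andP[bc ch] [Xc nX]] := @closed_last Y f (- b) (- h).
- by apply: closed_preimage_cts => // t; cts.
- by rewrite /Y /= opprK.
- by rewrite lerN2.
exists (- c); first by rewrite lerNr ch lerNl.
split=> // t /andP[ht tc] Xt; apply: (nX (- t)); last by rewrite /Y /= opprK.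
by rewrite ltrNr tc lerN2.
Qed.

Lemma gap_exists X (f a h b : R) : closed X -> X (f, a) -> X (f, b) ->
  a <= h <= b -> ~ X (f, h) ->
  exists a' b', [/\ a <= a' <= h, h <= b' <= b & gap X (f, a') (f, b')].
Proof.
move=> cX Xa Xb /andP[ah hb] nXh.
have [c lc [Xc nc]] := closed_last cX Xa ah.
have [d ld [Xd nd]] := closed_first cX Xb hb.
exists c, d; split=> //; split=> //=; last first.
  move=> t /andP[ct td]; have [th|ht] := leP t h; first by apply: nc; rewrite ct.
  by apply: nd; rewrite (ltW ht).
have ch : c != h by apply/eqP => e; rewrite e in Xc.
by case/andP: lc => _; case/andP: ld => + _; rewrite (lt_neqAle c); lra.
Qed.

Lemma gap_near X K (f0 a b : R) : locally_strip_joined X ->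
  (forall h, vhull K (f0, h) -> X (f0, h)) ->
  vhull K (f0, a) -> vhull K (f0, b) ->
  \forall u \near ((f0, a), (f0, b)),
    vhull K u.1 -> vhull K u.2 -> ~ gap X u.1 u.2.
Proof.
move=> lX HX Ha Hb; set u0 := ((f0, a), (f0, b)).
have [ba|ab|ab] := ltgtP b a.
- have : \forall u \near u0, u.2.2 - u.1.2 < 0.
    by apply: (near_lt (f := fun u => u.2.2 - u.1.2)); [cts|rewrite /= subr_lt0].
  by apply: filterS => u h _ _ [_ _ _ + _]; lra.
- have [V Va VX] := lX _ (HX _ Ha).
  have nV : \forall u \near u0, V u.1.
    have : {for u0, continuous fst} by exact: continuous_fst.
    exact.
  (* A strip from a point just above (f0, a) to a gap starting near (f0, a)
     enters all the gaps which are closer to (f0, a) on the same side. *)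
  have side (s : R) : \forall u \near u0, vhull K u.1 -> gap X u.1 u.2 ->
      s * (u.1.1 - f0) <= 0.
    have [[x1 [y1 [Vx1 g1 s1]]]|nog] := pselect (exists x1 y1,
        [/\ V x1, gap X x1 y1 & 0 < s * (x1.1 - f0)]); last first.
      move: nV; apply: filterS => u Vu _ gu; rewrite leNgt; apply/negP => su.
      by apply: nog; exists u.1, u.2.
    (* The strip has to start strictly between [a] and [b] to be inside nearby gaps, and inside [V]
       to be joined to [x1]. *)
    have [c /andP[ac cb] Vc] : exists2 c, a < c < b & V (f0, c).
      have nVa : \forall c \near a, V (f0, c).
        have : {for a, continuous (fun c => (f0, c))} by cts.
        exact.
      have : \forall c \near a^'+, V (f0, c) /\ a < c < b.
        have nVa' : \forall c \near a^'+, V (f0, c).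
          by apply: filterS nVa => c Vc _.
        near=> c; split; first by near: c.
        apply/andP; split; near: c; first exact: nbhs_right_gt.
        exact: nbhs_right_lt.
      by case/(@filter_ex _ (a^'+)) => c [? ?]; exists c.
    have Xc : X (f0, c).
      by apply: HX; apply: (vconvex_vhull Ha Hb); rewrite !ltW.
    have Xx1 : X x1 by case: g1.
    have [L [[cL LX iL vL] Lc Lx1 Luniq]] := VX _ _ Xc Vc Xx1 Vx1.
    have fx1 : f0 != x1.1.
      by apply/eqP => e; move: s1; rewrite e subrr mulr0 ltxx.
    have [w0 w00 wP] : exists2 e, 0 < e &
        forall w, L w -> `|w.1 - f0| < e -> (a + c) / 2 < w.2 < (c + b) / 2.
      apply: compact_slice => // w Lw wf.
      have -> : w = (f0, c) by exact: Luniq.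
      near=> z => _; apply/andP; split; near: z.
        by apply: (near_gt (f := snd)); [cts|rewrite /=; lra].
      by apply: (near_lt (f := snd)); [cts|rewrite /=; lra].
    near=> u => Hu [Xu1 Xu2 eu lu nu]; rewrite leNgt; apply/negP => su.
    have ua : u.1.2 < (a + c) / 2.
      by near: u; apply: (near_lt (f := fun u => u.1.2)); [cts|rewrite /=; lra].
    have ub : (c + b) / 2 < u.2.2.
      by near: u; apply: (near_gt (f := fun u => u.2.2)); [cts|rewrite /=; lra].
    have uf : `|u.1.1 - f0| < w0.
      by near: u; apply: (near_lt (f := fun u => `|u.1.1 - f0|));
        [cts|rewrite /= subrr normr0].
    have us : s * (u.1.1 - f0) < s * (x1.1 - f0).
      by near: u; apply: (near_lt (f := fun u => s * (u.1.1 - f0)));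
        [cts|rewrite /= subrr mulr0].
    have [w Lw wu] : (fst @` L) u.1.1.
      have [fx|fx|/eqP] := ltgtP f0 x1.1; last by rewrite (negbTE fx1).
        apply: (iL f0 x1.1); [by exists (f0, c)|by exists x1|].
        have s0 : 0 < s by have := s1; rewrite pmulr_lgt0 ?subr_gt0.
        by move: su us; rewrite ltr_pM2l // pmulr_rgt0 // subr_gt0 ltrD2r => *;
          rewrite !ltW.
      apply: (iL x1.1 f0); [by exists x1|by exists (f0, c)|].
      have s0 : s < 0 by have := s1; rewrite nmulr_lgt0 ?subr_lt0.
      by move: su us; rewrite ltr_nM2l // nmulr_rgt0 // subr_lt0 ltrD2r => *;
        rewrite !ltW.
    have /andP[wa wb] : (a + c) / 2 < w.2 < (c + b) / 2.
      by apply: wP => //; rewrite wu.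
    apply: (nu w.2); first by rewrite (lt_trans ua) //= (lt_trans wb).
    by rewrite -wu -surjective_pairing; exact: LX.
  (* With both sides excluded, a close gap lies over [f0] itself, where the hull fills the slice. *)
  have sp := side 1; have sn := side (-1).
  near=> u => Hu1 Hu2 gu.
  have p1 : vhull K u.1 -> gap X u.1 u.2 -> 1 * (u.1.1 - f0) <= 0 by near: u.
  have p2 : vhull K u.1 -> gap X u.1 u.2 -> -1 * (u.1.1 - f0) <= 0 by near: u.
  have {p1 p2}uf : u.1.1 = f0 by have := p1 Hu1 gu; have := p2 Hu1 gu; lra.
  case: gu => _ _ eu lu; case/(_ ((u.1.2 + u.2.2) / 2)); first lra.
  rewrite uf; apply: HX; apply: (vconvex_vhull (a := u.1.2) (b := u.2.2)).
  + by rewrite -uf -surjective_pairing.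
  + by rewrite -uf eu -surjective_pairing.
  + lra.
- rewrite {}ab in Hb u0 *; have [V Va VX] := lX _ (HX _ Ha).
  have n1 : \forall u \near u0, V u.1.
    have : {for u0, continuous fst} by exact: continuous_fst.
    exact.
  have n2 : \forall u \near u0, V u.2.
    have : {for u0, continuous snd} by exact: continuous_snd.
    exact.
  near=> u => _ _ [X1 X2 e12 l12 n12].
  have V1 : V u.1 by near: u.
  have V2 : V u.2 by near: u.
  have [L [[cL LX iL vL] L1 L2 _]] := VX _ _ X1 V1 X2 V2.
  apply: (n12 ((u.1.2 + u.2.2) / 2)); first lra.
  apply: LX; apply: (vL _ u.1.2 u.2.2); last lra.
    by rewrite -surjective_pairing.
  by rewrite e12 -surjective_pairing.
Unshelve. all: by end_near.
Qed.

(** The openness half of the sweeping argument. A hull point outside [X] produces a gap with both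
    ends in the hull, so it is enough to exclude gaps uniformly over the compact set of pairs of
    hull points. *)
Lemma vhull_open X K (f0 : R) : closed X -> locally_strip_joined X ->
  compact K -> K `<=` X -> (forall h, vhull K (f0, h) -> X (f0, h)) ->
  exists2 e, 0 < e & forall z, vhull K z -> `|z.1 - f0| < e -> X z.
Proof.
move=> cX lX cK KX HX; have cH := compact_vhull cK.
have [] := @compact_near_zero R _ (vhull K `*` vhull K)
    (fun u => `|u.1.1 - f0| + `|u.2.1 - f0|) (fun u => ~ gap X u.1 u.2).
- exact: compact_setX.
- by move=> u _; cts.
- case=> -[f1 a] [f2 b] [/= H1 H2] le0.
  have [e1 e2] : f1 = f0 /\ f2 = f0.
    have := normr_ge0 (f1 - f0); have := normr_ge0 (f2 - f0).
    by split; apply/eqP; rewrite -subr_eq0 -normr_eq0; apply/eqP; lra.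
  move: H1 H2; rewrite {}e1 {}e2 => H1 H2.
  by apply: filterS (gap_near lX HX H1 H2) => u h [? ?]; exact: h.
move=> e e0 He; exists (e / 2) => [|[f h] Hz /= fe]; first lra.
apply: contrapT => nX; have [a [b [/= Ka Kb hab]]] := Hz.
have [a' [b' [la lb g]]] := gap_exists cX (KX _ Ka) (KX _ Kb) hab nX.
apply: (He ((f, a'), (f, b'))) g; last by rewrite /=; lra.
have [H1 H2] := (sub_vhull Ka, sub_vhull Kb).
by split; rewrite /=; apply: (vconvex_vhull H1 H2); lra.
Qed.

End Gaps.

Section VerticalConvexity.
Context {R : realType}.
Implicit Types (K L X : set (R * R)) (x y : R * R).

Lemma strip_side X L (f h : R) : strip X L -> ~ X (f, h) ->
  (forall z, L z -> z.1 = f -> z.2 < h) \/ (forall z, L z -> z.1 = f -> h < z.2).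
Proof.
move=> [_ LX _ vL] nX.
have [|] := pselect (forall z, L z -> z.1 = f -> z.2 < h); first by left.
move=> /existsNP[[f' a]] /not_implyP[La /not_implyP[/= e /negP]];
  rewrite -leNgt => ha.
right; rewrite {}e {f'} in La.
move=> [f' b] /= Lb e; rewrite {}e {f'} in Lb; rewrite ltNge; apply/negP => bh.
by apply/nX/LX/(vL _ b a) => //; rewrite bh.
Qed.

Lemma near_between L1 L2 (f h : R) : compact L1 -> compact L2 ->
  (forall z, L1 z -> z.1 = f -> z.2 < h) ->
  (forall z, L2 z -> z.1 = f -> h < z.2) ->
  \forall g \near f, forall a b, L1 (g, a) -> L2 (g, b) -> a < h < b.
Proof.
move=> c1 c2 l1 l2.
have [e1 e10 h1] : exists2 e, 0 < e &
    forall z, L1 z -> `|z.1 - f| < e -> z.2 < h.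
  apply: compact_slice => // z Lz zf.
  by apply: filterS (near_lt (continuous_snd (x := z)) (l1 _ Lz zf)).
have [e2 e20 h2] : exists2 e, 0 < e &
    forall z, L2 z -> `|z.1 - f| < e -> h < z.2.
  apply: compact_slice => // z Lz zf.
  by apply: filterS (near_gt (continuous_snd (x := z)) (l2 _ Lz zf)).
near=> g => a b La Lb.
have g1 : `|g - f| < e1.
  by near: g; apply: (near_lt (f := fun g => `|g - f|));
    [cts|rewrite subrr normr0].
have g2 : `|g - f| < e2.
  by near: g; apply: (near_lt (f := fun g => `|g - f|));
    [cts|rewrite subrr normr0].
by rewrite (h1 _ La g1) (h2 _ Lb g2).
Unshelve. all: by end_near.
Qed.

(** Over an abscissa met by only one of the strips, the hull is that strip. The abscissae met by
    both form an interval [I], and the set [T] of those over which the hull lies in [X] is open and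
    closed in it. *)
Lemma strip_union X K1 K2 y : closed X -> locally_strip_joined X ->
  strip X K1 -> strip X K2 -> K1 y -> K2 y ->
  strip X (vhull (K1 `|` K2)).
Proof.
move=> cX lX s1 s2 y1 y2.
have [c1 X1 i1 v1] := s1; have [c2 X2 i2 v2] := s2.
pose K := K1 `|` K2.
have cK : compact K by exact: compactU.
have KX : K `<=` X by rewrite subUset.
pose I := (fst @` K1) `&` (fst @` K2).
pose T f := forall h, vhull K (f, h) -> X (f, h).
have IT : I `<=` T.
  apply: (connected_locally_constant (x0 := y.1)).
  - apply/connected_intervalP => a b [a1 a2] [b1 b2] c abc.
    by split; [exact: (i1 a b)|exact: (i2 a b)].
  - by split; exists y.
  (* Both strips contain the point at height [h0], so the part of the hull on either side of it lies
     in a single strip. *)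
  - case: y y1 y2 => f h0 y1 y2 h [a [b [/= Ka Kb /andP[ah hb]]]].
    have [hh|hh] := leP h h0.
      case: Ka => Ka; first by apply/X1/(v1 _ a h0) => //; rewrite ah.
      by apply/X2/(v2 _ a h0) => //; rewrite ah.
    case: Kb => Kb; first by apply/X1/(v1 _ h0 b) => //; rewrite (ltW hh).
    by apply/X2/(v2 _ h0 b) => //; rewrite (ltW hh).
  - move=> f _ Tf; have [e e0 eP] := vhull_open cX lX cK KX Tf.
    have : \forall g \near f, `|g - f| < e.
      by apply: (near_lt (f := fun g => `|g - f|)); [cts|rewrite subrr normr0].
    by apply: filterS => g gf _ h Hh; exact: (eP (g, h)).
  (* Since [(f, h)] is in the hull but not in [X], the two strips pass on opposite sides of it. This
     persists for nearby abscissae at the same height [h], and so does being outside [X]. *)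
  - move=> f _ /existsNP[h /not_implyP[Hh nX]].
    have nXn : \forall g \near f, ~ X (g, h).
      have : open ((fun g => (g, h)) @^-1` (~` X)).
        rewrite -closedC preimage_setC setCK.
        by apply: closed_preimage_cts => // g; cts.
      by move/(_ f nX).
    have opp L1 L2 : compact L1 -> compact L2 ->
        (forall z, L1 z -> z.1 = f -> z.2 < h) ->
        (forall z, L2 z -> z.1 = f -> h < z.2) ->
        L1 `<=` K -> L2 `<=` K ->
        \forall g \near f, (fst @` L1) g -> (fst @` L2) g -> ~ T g.
      move=> cL1 cL2 l1 l2 K1' K2'.
      have := near_between cL1 cL2 l1 l2.
      apply: filterS2 nXn => g nXg ab.
      move=> [[g1 a] /= La e1] [[g2 b] /= Lb e2] Tg; subst g1 g2.
      apply/nXg/Tg; exists a, b; split; [exact: K1'|exact: K2'|].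
      by have /andP[? ?] := ab _ _ La Lb; rewrite !ltW.
    have [a [b [/= Ka Kb /andP[ah hb]]]] := Hh.
    have subl : K1 `<=` K by move=> ?; left.
    have subr : K2 `<=` K by move=> ?; right.
    have [l1|l1] := strip_side s1 nX; have [l2|l2] := strip_side s2 nX.
    + by case: Kb => /[dup] Kb; [move=> /l1|move=> /l2] => /(_ erefl) /=; lra.
    + by apply: filterS (opp _ _ c1 c2 l1 l2 subl subr) => g h' [? ?]; exact: h'.
    + by apply: filterS (opp _ _ c2 c1 l2 l1 subr subl) => g h' [? ?]; exact: h'.
    + by case: Ka => /[dup] Ka; [move=> /l1|move=> /l2] => /(_ erefl) /=; lra.
split.
- exact: compact_vhull.
- move=> [f h] Hz; have [a [b [/= Ka Kb ahb]]] := Hz.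
  case: Ka => Ka; case: Kb => Kb.
  + exact/X1/(v1 _ a b).
  + by apply: (IT f) => //; split; [exists (f, a)|exists (f, b)].
  + by apply: (IT f) => //; split; [exists (f, b)|exists (f, a)].
  + exact/X2/(v2 _ a b).
- have iU : is_interval ((fst @` K1) `|` (fst @` K2)).
    apply/connected_intervalP; apply: connectedU.
    + by exists y.1; split; exists y.
    + exact/connected_intervalP.
    + exact/connected_intervalP.
  suff -> : fst @` vhull (K1 `|` K2) = (fst @` K1) `|` (fst @` K2) by [].
  apply/seteqP; split=> f.
    by move=> [z [a [b [[Ka|Ka] _ _]]] <-]; [left|right]; exists (z.1, a).
  by move=> [[z Kz <-]|[z Kz <-]]; exists z => //; apply: sub_vhull; [left|right].
- exact: vconvex_vhull.
Qed.

(** The points lying with [(f, a)] in a common strip form an open and closed subset of [X], by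
    [strip_union]. So one strip contains both ends, and it is vertically convex. *)
Theorem vconvex_of_locally_strip_joined X : closed X -> connected X ->
  locally_strip_joined X -> vconvex X.
Proof.
move=> cX conX lX f a b h Xa Xb ahb.
pose P y := exists K, [/\ strip X K, K (f, a) & K y].
have joinP x y : P x -> (exists K, strip_joined X K x y) -> P y.
  move=> [K [sK Ka Kx]] [L [sL Lx Ly _]].
  exists (vhull (K `|` L)); split; first exact: (strip_union cX lX sK sL Kx Lx).
    by apply: sub_vhull; left.
  by apply: sub_vhull; right.
suff /(_ _ Xb) [K [[_ KX _ vK] Ka Kb]] : X `<=` P by exact/KX/(vK _ a b).
apply: (connected_locally_constant (x0 := (f, a))) => //.
- have [V Va VX] := lX _ Xa; have Vfa := nbhs_singleton Va.
  have [K [sK ? ? _]] := VX _ _ Xa Vfa Xa Vfa.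
  by exists K.
- move=> x Xx Px; have [V Vx VX] := lX _ Xx.
  apply: filterS (Vx) => y Vy Xy; apply: (joinP x) => //.
  by apply: VX => //; exact: nbhs_singleton.
- move=> x Xx nPx; have [V Vx VX] := lX _ Xx.
  apply: filterS (Vx) => y Vy Xy Py; apply: nPx; apply: (joinP y) => //.
  by apply: VX => //; exact: nbhs_singleton.
Qed.

End VerticalConvexity.

(** * Segments and the Tietze-Nakajima theorem *)

Definition lin {R : realType} (a b t : R) : R := a + t * (b - a).

Section Segments.
Context {R : realType}.
Implicit Types (X : set (R * R)) (x y z : R * R) (a b t : R).

Lemma lin0 a b : lin a b 0 = a. Proof. by rewrite /lin mul0r addr0. Qed.

Lemma lin1 a b : lin a b 1 = b. Proof. by rewrite /lin mul1r addrC subrK. Qed.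

Lemma linaa a t : lin a a t = a. Proof. by rewrite /lin subrr mulr0 addr0. Qed.

Lemma cts_lin a b t : {for t, continuous (lin a b)}.
Proof. by rewrite /lin; cts. Qed.

Lemma lin_between a b h : a <= h <= b ->
  exists2 t, 0 <= t <= 1 & lin a b t = h.
Proof.
move=> /andP[ah hb]; have [ab|ab] := eqVneq a b.
  exists 0; first by rewrite lexx ler01.
  by rewrite lin0; apply/le_anti; rewrite ah ab.
have b_a : 0 < b - a by rewrite subr_gt0 lt_neqAle ab (le_trans ah hb).
exists ((h - a) / (b - a)); last by rewrite /lin divfK ?gt_eqF // addrC subrK.
rewrite divr_ge0 ?(ltW b_a) ?subr_ge0 //=.
by rewrite ler_pdivrMr // mul1r lerB.
Qed.

Lemma lin_itv (s t r : R) : 0 <= s <= 1 -> 0 <= t <= 1 -> 0 <= r <= 1 ->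
  0 <= lin s t r <= 1.
Proof.
move=> /andP[s0 s1] /andP[t0 t1] /andP[r0 r1].
have -> : lin s t r = (1 - r) * s + r * t by rewrite /lin; ring.
have r1' : 0 <= 1 - r by rewrite subr_ge0.
rewrite addr_ge0 ?mulr_ge0 //=.
have := ler_wpM2l r1' s1; have := ler_wpM2l r0 t1; lra.
Qed.

Lemma lin_lin a b s t r : lin a b (lin s t r) = lin (lin a b s) (lin a b t) r.
Proof. by rewrite /lin; ring. Qed.

Lemma max_lin (a b t : R) : 0 <= t <= 1 ->
  Num.max (lin a b t) 0 <= lin (Num.max a 0) (Num.max b 0) t.
Proof.
move=> /andP[t0 t1]; pose r := 1 - t; have r0 : 0 <= r by rewrite subr_ge0.
have linE u v : lin u v t = r * u + t * v by rewrite /lin /r; ring.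
rewrite !linE ge_max; apply/andP; split.
  by rewrite lerD // ler_wpM2l // le_max lexx.
by rewrite addr_ge0 // mulr_ge0 // le_max lexx orbT.
Qed.

Lemma lin_ge (a b m t : R) : m <= a -> m <= b -> 0 <= t <= 1 -> m <= lin a b t.
Proof.
move=> ma mb /andP[t0 t1]; pose r := 1 - t.
have r0 : 0 <= r by rewrite subr_ge0.
have -> : lin a b t = m + (r * (a - m) + t * (b - m)) by rewrite /lin /r; ring.
by rewrite lerDl addr_ge0 // mulr_ge0 // subr_ge0.
Qed.

Lemma lin_le (a b m t : R) : a <= m -> b <= m -> 0 <= t <= 1 -> lin a b t <= m.
Proof.
move=> am bm t01; rewrite -lerN2 (_ : - lin a b t = lin (- a) (- b) t).
  by apply: lin_ge; rewrite ?lerN2.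
by rewrite /lin; ring.
Qed.

Lemma max_lin_same_sign (a b t : R) : 0 <= a * b -> 0 <= t <= 1 ->
  Num.max (lin a b t) 0 = lin (Num.max a 0) (Num.max b 0) t.
Proof.
move=> ab t01; have [[a0 b0]|[a0 b0]] : (0 <= a /\ 0 <= b) \/ (a <= 0 /\ b <= 0).
- have [a0|a0|a0] := ltgtP a 0.
  + by right; split=> //; rewrite nmulr_rge0 in ab.
  + by left; split=> //; rewrite pmulr_rge0 in ab.
  + by have [b0|b0] := leP 0 b; [left|right; split=> //; exact: ltW].
- by rewrite !max_l // lin_ge.
- by rewrite !max_r // ?linaa // lin_le.
Qed.

Lemma lin_dist (m a b e t : R) : `|m - a| < e -> `|m - b| < e -> 0 <= t <= 1 ->
  `|m - lin a b t| < e.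
Proof.
move=> am bm t01; pose n := Num.max `|m - a| `|m - b|.
have an : `|m - a| <= n by rewrite le_max lexx.
have bn : `|m - b| <= n by rewrite le_max lexx orbT.
apply: (@le_lt_trans _ _ n); last by rewrite gt_max am.
move: an bn; rewrite !(distrC m) !ler_distl => /andP[? ?] /andP[? ?].
by rewrite lin_ge ?lin_le.
Qed.

Lemma lin_eq0_uniq (a b s t : R) : a != b -> lin a b s = lin a b t -> s = t.
Proof.
move=> ab /addrI/mulIf; apply; by rewrite subr_eq0 eq_sym.
Qed.

Definition segment x y : set (R * R) :=
  (fun t => (lin x.1 y.1 t, lin x.2 y.2 t)) @` `[0, 1].

Lemma segment_strip_joined X x y : segment x y `<=` X ->
  strip_joined X (segment x y) x y.
Proof.
move=> sX; pose g t := (lin x.1 y.1 t, lin x.2 y.2 t).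
have gc t : {for t, continuous g} by rewrite /g /lin; cts.
split; last 1 first.
- move=> xy z [t _ <-] /= /eqP; rewrite /lin -subr_eq0 addrAC subrr add0r.
  rewrite mulf_eq0 subr_eq0 (eq_sym y.1) (negbTE xy) orbF => /eqP ->.
  by rewrite !mul0r !addr0 -surjective_pairing.
- split => //.
  + apply: continuous_compact; last exact: segment_compact.
    by apply: within_cts => t _; exact: gc.
  + apply/connected_intervalP; rewrite /segment image_comp.
    apply: connected_continuous_connected; first exact: segment_connected.
    by apply: within_cts => t _ /=; exact: cts_lin.
  + move=> f a b h [s s01 [sf sa]] [t t01 [tf tb]] /lin_between[r r01 rh].
    rewrite /= !in_itv /= in s01 t01.
    exists (lin s t r); first by rewrite /= in_itv /= lin_itv.
    by rewrite !lin_lin sf tf sa tb linaa rh.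
- by exists 0; rewrite /= ?in_itv /= ?lexx ?ler01 // !lin0 -surjective_pairing.
- by exists 1; rewrite /= ?in_itv /= ?lexx ?ler01 // !lin1 -surjective_pairing.
Qed.

Theorem tietze_nakajima X : compact X -> connected X ->
  (forall p, X p -> exists2 V, nbhs p V &
    forall x y, X x -> V x -> X y -> V y -> segment x y `<=` X) ->
  forall x y, X x -> X y -> segment x y `<=` X.
Proof.
move=> cX conX lX x y Xx Xy.
have [->|xy] := eqVneq x y.
  by move=> _ [t _ <-]; rewrite !linaa -surjective_pairing.
pose u := y.1 - x.1; pose v := y.2 - x.2; pose N := u * u + v * v.
have N0 : N != 0.
  apply: contraNneq xy => /eqP.
  rewrite /N paddr_eq0 -?expr2 ?sqr_ge0 // !sqrf_eq0 !subr_eq0.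
  move=> /andP[/eqP e1 /eqP e2].
  by apply/eqP; rewrite [x]surjective_pairing [y]surjective_pairing e1 e2.
(* [L] is the similarity given by the determinant and the scalar product with [y - x]. It sends
   [y - x] to [(0, N)], which makes the segment vertical, and its square is multiplication by [N],
   whence its inverse [M]. *)
pose L z : R * R := (u * z.2 - v * z.1, u * z.1 + v * z.2).
pose M z : R * R := ((u * z.2 - v * z.1) / N, (u * z.1 + v * z.2) / N).
have LK : cancel L M.
  by case=> a b; rewrite /M /L /=; congr pair; rewrite /N in N0 *; field.
have Lc z : {for z, continuous L} by rewrite /L; cts.
have Mc z : {for z, continuous M} by rewrite /M; cts.
have Lseg (a b : R * R) : L @` segment a b = segment (L a) (L b).
  rewrite /segment image_comp; apply: eq_imagel => t _ /=.
  by rewrite /L /lin /=; congr pair; ring.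
have vLX : vconvex (L @` X).
  have wL : {within X, continuous L} by apply: within_cts => ? _; exact: Lc.
  apply: vconvex_of_locally_strip_joined.
  - apply: compact_closed; first exact: norm_hausdorff.
    exact: continuous_compact.
  - exact: connected_continuous_connected.
  - move=> _ [p Xp <-]; have [V Vp VX] := lX _ Xp.
    exists (M @^-1` V); first by apply: Mc; rewrite LK.
    move=> _ _ [a Xa <-] /= Va [b Xb <-] /= Vb; rewrite !LK in Va Vb.
    exists (segment (L a) (L b)); apply: segment_strip_joined.
    by rewrite -Lseg; apply: image_subset; exact: VX.
suff LS : L @` segment x y `<=` L @` X.
  by move=> z sz; have [|z' Xz' /(can_inj LK) <-] := LS (L z); first by exists z.
have Lx1 : (L x).1 = (L y).1 by rewrite /L /= /u /v; ring.
have Lx2 : (L x).2 <= (L y).2.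
  rewrite -subr_ge0 (_ : _ - _ = N); first by rewrite addr_ge0 -?expr2 ?sqr_ge0.
  by rewrite /L /N /u /v /=; ring.
rewrite Lseg => _ [t t01 <-].
have /andP[t0 t1] : 0 <= t <= 1 by move: t01; rewrite /= in_itv.
rewrite -[_ (_, _)]/((L @` X) (lin (L x).1 (L y).1 t, lin (L x).2 (L y).2 t)).
rewrite -Lx1 linaa; apply: (vLX _ (L x).2 (L y).2).
- by rewrite -surjective_pairing; exists x.
- by rewrite Lx1 -surjective_pairing; exists y.
- exact: itv_convex.
Qed.

End Segments.

(** * Affine functions on intervals *)

Definition affine_on {R : realType} (a b : R) (f : R -> R) :=
  exists p q, forall t, a <= t <= b -> f t = p + q * t.

Section AffineFunctions.
Context {R : realType}.
Implicit Types (a b s t : R) (f g : R -> R).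

Lemma affine_on_sub a b s t f : a <= s -> t <= b -> affine_on a b f ->
  affine_on s t f.
Proof. by move=> ? ? [p [q h]]; exists p, q => u ?; apply: h; lra. Qed.

Lemma affine_on_ext a b f g : (forall t, a <= t <= b -> f t = g t) ->
  affine_on a b f -> affine_on a b g.
Proof. by move=> e [p [q h]]; exists p, q => u ?; rewrite -e // h. Qed.

Lemma affine_on_comb a b (x y z : R) f g : affine_on a b f -> affine_on a b g ->
  affine_on a b (fun t => x + y * f t + z * g t).
Proof.
move=> [p [q h]] [p' [q' h']]; exists (x + y * p + z * p'), (y * q + z * q').
by move=> t abt; rewrite h // h' //; ring.
Qed.

(** A form without coefficients or division: it passes to pointwise limits, and its failure at one
    time is an open condition. *)
Lemma affine_onP a b f : a < b -> affine_on a b f <->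
  forall t, a <= t <= b -> (f t - f a) * (b - a) = (t - a) * (f b - f a).
Proof.
move=> ab; split=> [[p [q h]] t abt|h].
  by rewrite !h ?lexx ?(ltW ab) //; ring.
have ba : b - a != 0 by rewrite subr_eq0 gt_eqF.
exists (f a - a * (f b - f a) / (b - a)), ((f b - f a) / (b - a)) => t abt.
apply: (mulIf ba); rewrite mulrDl mulrBl divfK // [X in _ = _ + X]mulrAC divfK //.
by have := h t abt; rewrite mulrBl => /eqP; rewrite subr_eq => /eqP ->; ring.
Qed.

Lemma affine_on_lin a b f t : affine_on a b f -> 0 <= t <= 1 -> a <= b ->
  f (lin a b t) = lin (f a) (f b) t.
Proof.
move=> [p [q h]] /andP[t0 t1] ab; rewrite !h ?lexx ?ab ?itv_convex //.
by rewrite /lin; ring.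
Qed.

Definition locally_affine a b f := forall t, a < t < b ->
  exists s s', s < t < s' /\ affine_on s s' f.

(** The times near which [f] agrees with the affine function found at the midpoint form an open and
    closed subset of the open interval, since affine functions agreeing on an overlap are equal.
    Continuity covers the ends. *)
Lemma affine_of_locally_affine a b f : a <= b ->
  {within `[a, b], continuous f} -> locally_affine a b f -> affine_on a b f.
Proof.
rewrite le_eqVlt => /predU1P[->|ab] fc lf.
  by exists (f b), 0 => t /le_anti <-; rewrite mul0r addr0.
have [s [s' [sm [p [q h]]]]] := lf ((a + b) / 2) ltac:(lra).
pose T t := exists r r', r < t < r' /\ forall u, r <= u <= r' -> f u = p + q * u.
have TT : `]a, b[ `<=` T.
  apply: (connected_locally_constant (x0 := (a + b) / 2)).
  - exact/connected_intervalP/interval_is_interval.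
  - by rewrite /= in_itv /=; lra.
  - by exists s, s'.
  - move=> t _ [r [r' [/andP[rt tr] fr]]].
    near=> y => _; exists r, r'; split=> //; apply/andP; split; near: y.
      exact: lt_nbhsr.
    exact: lt_nbhsl.
  - move=> t; rewrite /= in_itv /= => abt nT.
    have [r [r' [/andP[rt tr] [p' [q' h']]]]] := lf t abt.
    have nr : \forall y \near t, r < y < r'.
      by near=> y; apply/andP; split; near: y; [exact: lt_nbhsr|exact: lt_nbhsl].
    apply: filterS nr => y ry _ [v [v' [vy fv]]]; apply: nT.
    exists r, r'; split; first by rewrite rt.
    pose m := Num.min r' v'; pose l := Num.max r v.
    have lm : l < m by rewrite /l /m gt_max !lt_min; lra.
    have eq2 u : l <= u <= m -> p' + q' * u = p + q * u.
      rewrite /l /m ge_max !le_min => ?; rewrite -h' ?fv; lra.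
    have e1 : p' + q' * m = p + q * m by apply: eq2; rewrite lexx ltW.
    have e2 : p' + q' * l = p + q * l by apply: eq2; rewrite lexx ltW.
    have eq : q' = q.
      apply/eqP; rewrite -subr_eq0; apply/eqP.
      apply: (@mulIf _ (m - l)); first by rewrite subr_eq0 gt_eqF.
      by rewrite mul0r mulrBr !mulrBl; lra.
    have ep : p' = p by move: e1; rewrite eq; lra.
    by move=> u ru; rewrite h' // ep eq.
have fe t : a < t < b -> f t = p + q * t.
  move=> abt; have [|r [r' [rt hr]]] := TT t; first by rewrite /= in_itv.
  by apply: hr; lra.
have [_ fa fb] := (continuous_within_itvP f ab).1 fc.
exists p, q => t; rewrite le_eqVlt => /andP[/predU1P[<-|at_]].
  move=> _; apply: (@cvg_unique _ _ (f @ a^'+)) => //.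
  have : (fun t => p + q * t) @ a^'+ --> p + q * a.
    apply: cvg_at_right_filter.
    by have : {for a, continuous (fun t => p + q * t)} by cts.
  apply: cvg_trans; apply: near_eq_cvg; near=> y; rewrite fe //.
  by apply/andP; split; near: y; [exact: nbhs_right_gt|exact: nbhs_right_lt].
rewrite le_eqVlt => /predU1P[->|tb]; last by apply: fe; rewrite at_.
apply: (@cvg_unique _ _ (f @ b^'-)) => //.
have : (fun t => p + q * t) @ b^'- --> p + q * b.
  apply: cvg_at_left_filter.
  by have : {for b, continuous (fun t => p + q * t)} by cts.
apply: cvg_trans; apply: near_eq_cvg; near=> y; rewrite fe //.
by apply/andP; split; near: y; [exact: nbhs_left_gt|exact: nbhs_left_lt].
Unshelve. all: by end_near.
Qed.

Lemma affine_on_lim a b (f_ : nat -> R -> R) f : a < b ->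
  (\forall n \near \oo, affine_on a b (f_ n)) ->
  (forall t, a <= t <= b -> f_ n t @[n --> \oo] --> f t) -> affine_on a b f.
Proof.
move=> ab fa fl; apply/(affine_onP _ ab) => t abt.
have la := fl a; have lb := fl b; move: la lb; rewrite !lexx ltW // => la lb.
have l1 : (f_ n t - f_ n a) * (b - a) @[n --> \oo] --> (f t - f a) * (b - a).
  by apply: cvgM; [apply: cvgB; [exact: fl|exact: la]|exact: cvg_cst].
have l2 : (t - a) * (f_ n b - f_ n a) @[n --> \oo] --> (t - a) * (f b - f a).
  by apply: cvgM; [exact: cvg_cst|apply: cvgB; [exact: lb|exact: la]].
apply: (cvg_unique _ _ l2) => //.
apply: cvg_trans l1; apply: near_eq_cvg; apply: filterS fa => n.
by move=> /(affine_onP _ ab) /(_ t abt).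
Qed.

Lemma affine_on_pq p q a b f :
  (forall t, a <= t <= b -> f t = p + q * t) -> affine_on a b f.
Proof. by move=> h; exists p, q. Qed.

Lemma degenerate_pair (b1 b2 b1' b2' : R) : b1 * b2' = b2 * b1' ->
  exists v : R * R,
    [/\ v <> 0, b1 * v.1 + b2 * v.2 = 0 & b1' * v.1 + b2' * v.2 = 0].
Proof.
move=> det; have [e2|n2] := eqVneq b2 0; last first.
  exists (b2, - b1) => /=; split; [by case=> /eqP; rewrite (negbTE n2)|ring|].
  by rewrite mulrN (mulrC b2') det; ring.
have [e1|n1] := eqVneq b1 0; last first.
  exists (b2, - b1) => /=; split; [|ring|by rewrite mulrN (mulrC b2') det; ring].
  by case=> _ /eqP; rewrite oppr_eq0 (negbTE n1).
rewrite e1 e2; have [e2'|n2'] := eqVneq b2' 0; last first.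
  exists (b2', - b1') => /=; split; [by case=> /eqP;
    rewrite (negbTE n2')|ring|ring].
rewrite e2'; exists (0, 1) => /=; split; [|ring|ring].
by case=> /eqP; rewrite oner_eq0.
Qed.

End AffineFunctions.

Lemma near_subitv {R : realType} (a b t : R) (P : R -> Prop) : a < t < b ->
  (\forall u \near t, P u) ->
  exists s s', [/\ a <= s, s < t < s', s' <= b & forall u, s <= u <= s' -> P u].
Proof.
move=> abt /nbhs_ballP[e /= e0 eP].
exists (Num.max a (t - e / 2)), (Num.min b (t + e / 2)).
rewrite ge_min le_max !lexx /= gt_max lt_min; split=> //; first lra.
move=> u; rewrite ge_max le_min => u_; apply: eP.
rewrite /ball /= distrC ltr_norml; lra.
Qed.

(** [al] stands for F along a line and [be] for the two branches. Near a time where [al] does not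
    vanish, its positive part is affine, so if one branch is affine there the other is too
    ([switch]). *)
Lemma affine_on_broken {R : realType} (a b k : R) (al : R -> R)
    (be : bool -> R -> R) : a <= b -> affine_on a b al ->
  (forall c, {within `[a, b], continuous (be c)}) ->
  (forall t, a <= t <= b -> be true t + be false t = k * Num.max (al t) 0) ->
  (forall t, a < t < b -> exists c s s', s < t < s' /\ affine_on s s' (be c)) ->
  exists c, affine_on a b (be c).
Proof.
move=> ab afal bec sum loc.
have switch c t s s' r r' : a < t < b -> s < t < s' -> affine_on s s' (be c) ->
    r < t < r' -> affine_on r r' (fun u => Num.max (al u) 0) ->
    exists s s', s < t < s' /\ affine_on s s' (be (~~ c)).
  move=> abt st afs rt afr.
  exists (Num.max a (Num.max s r)), (Num.min b (Num.min s' r')).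
  split; first by rewrite !gt_max !lt_min; lra.
  apply: (@affine_on_ext _ _ _ (fun u => 0 + k * Num.max (al u) 0 + (- 1) * be
    c u)).
    move=> u; rewrite !ge_max !le_min => u_.
    have <- : be true u + be false u = k * Num.max (al u) 0 by apply: sum; lra.
    by case: (c) => /=; ring.
  apply: (@affine_on_comb _ _ _ 0 k (-1) (fun u => Num.max (al u) 0)).
    by apply: affine_on_sub afr; rewrite ?le_max ?ge_min ?lexx ?orbT.
  by apply: affine_on_sub afs; rewrite ?le_max ?ge_min ?lexx ?orbT.
have posn t : a < t < b -> al t != 0 ->
    exists r r', r < t < r' /\ affine_on r r' (fun u => Num.max (al u) 0).
  move=> abt alt0; have [p [q alE]] := afal.
  have ct : {for t, continuous (fun u => p + q * u)} by cts.
  have [lt0|gt0|/eqP] := ltgtP (al t) 0; last by rewrite (negbTE alt0).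
    have [|s [s' [sa st sb h]]] := near_subitv abt (near_lt (a := 0) ct _).
      by rewrite -alE //; lra.
    exists s, s'; split=> //; exists 0, 0 => u su.
    rewrite mul0r addr0; apply/max_idPr/ltW; rewrite alE; first exact: h.
    by case/andP: su => ? ?; lra.
  have [|s [s' [sa st sb h]]] := near_subitv abt (near_gt (a := 0) ct _).
    by rewrite -alE //; lra.
  exists s, s'; split=> //; apply: (@affine_on_ext _ _ _ al).
    move=> u su; apply/esym/max_idPl/ltW; rewrite alE; first exact: h.
    by case/andP: su => ? ?; lra.
  exact: affine_on_sub afal.
have fin c : (forall t, a < t < b ->
      exists s s', s < t < s' /\ affine_on s s' (be c)) ->
    exists c, affine_on a b (be c).
  by move=> lc; exists c; apply: affine_of_locally_affine.
(* If [al] is not identically zero, it vanishes at one interior time at most, and the branch that is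
   affine there is affine everywhere. Without such a time, the positive part is locally affine
   throughout and either branch works. *)
have [[t0 [abt0 al0 alN]]|none] := pselect (exists t0,
    [/\ a < t0 < b, al t0 = 0 & exists2 t1, a <= t1 <= b & al t1 <> 0]).
  have [c [s [s' [st0 afc]]]] := loc t0 abt0; apply: (fin c) => t abt.
  have [->|tt0] := eqVneq t t0; first by exists s, s'.
  have alt : al t != 0.
    apply/eqP => alt; case: alN => t1 abt1; apply.
    have [p [q alE]] := afal; rewrite !alE in al0 alt *; try lra.
    have q0 : q = 0.
      apply: (@mulIf _ (t - t0)); first by rewrite subr_eq0.
      by rewrite mul0r mulrBr; lra.
    by move: al0; rewrite q0; lra.
  have [r [r' [rt afr]]] := posn t abt alt.
  have [c' [s1 [s1' [st af]]]] := loc t abt.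
  have [<-|cc'] := eqVneq c' c; first by exists s1, s1'.
  have := switch _ _ _ _ _ _ abt st af rt afr.
  by case: (c) (c') cc' => -[].
apply: (fin true) => t abt; have [[] [s [s' [st af]]]] := loc t abt.
  by exists s, s'.
suff [r [r' [rt afr]]] : exists r r', r < t < r' /\
    affine_on r r' (fun u => Num.max (al u) 0).
  exact: (switch false t s s' r r').
have [alt|] := eqVneq (al t) 0; last exact: posn.
exists a, b; split=> //; exists 0, 0 => u abu; rewrite mul0r addr0.
suff -> : al u = 0 by rewrite maxxx.
by apply: contrapT => alu; apply: none; exists t; split=> //; exists u.
Qed.

(** * The focus box *)

Section FocusBox.
Context {R : realType} {M : metricType R} (S : singular_affine_surface M).
Context (O : M) (c : chart M) (Gl Gr : M -> R) (k d d' : R).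
Context (mc : multivalued_coordinates S O c Gl Gr k).
Context (d_gt0 : 0 < d) (d'_gt0 : 0 < d').

Local Notation D := (chart_dom c).
Local Notation inv := (chart_inv c).
Local Notation F x := (c x).1.
Local Notation H x := (c x).2.
Local Notation gl := (Gl \o inv).

Let B := [set x | [/\ D x, - d <= F x <= d, - d' <= Gl x <= d'
                     & - d' <= Gr x <= d']].

Context (cB : compact B) (conB : connected B).

Lemma chart_inj x y : D x -> D y -> F x = F y -> H x = H y -> x = y.
Proof.
move=> Dx Dy ef eh; rewrite -(chart_invK Dx) -(chart_invK Dy); congr inv.
by rewrite [c x]surjective_pairing ef eh -surjective_pairing.
Qed.

Lemma continuous_F x : D x -> {for x, continuous (fun x => F x)}.
Proof. by move=> Dx; apply/cts_fst/chart_map_continuous. Qed.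

Lemma continuous_H x : D x -> {for x, continuous (fun x => H x)}.
Proof. by move=> Dx; apply/cts_snd/chart_map_continuous. Qed.

Lemma GrE x : D x -> Gr x = Gl x + k * Num.max (F x) 0.
Proof.
move=> Dx; have [F0|F0] := leP 0 (F x); first exact: (mc_right mc).
by rewrite (mc_left mc) ?mulr0 ?addr0 // ltW.
Qed.

Lemma GlO : Gl O = 0. Proof. exact: mc_Gl_O mc. Qed.

Lemma FO : F O = 0. Proof. by rewrite (mc_O mc). Qed.

Lemma HO : H O = 0. Proof. by rewrite (mc_O mc). Qed.

Lemma k_gt0 : 0 < k. Proof. exact: mc_index mc. Qed.

(** The image of the box under (F, Gl). As Gl <= Gr, the bounds on the two branches amount to a
    lower bound on Gl and an upper bound on Gr. The latter is convex in [(f, g)] because [k] is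
    positive, so this region is convex. *)
Definition inQ (f g : R) := [/\ - d <= f <= d, - d' <= g &
  g + k * Num.max f 0 <= d'].

Lemma box_inQ x : D x -> B x <-> inQ (F x) (Gl x).
Proof.
move=> Dx; have m0 : 0 <= k * Num.max (F x) 0.
  by rewrite mulr_ge0 ?(ltW k_gt0) // le_max lexx orbT.
rewrite /B /= GrE //; split=> [[_ ? /andP[? _] /andP[_ ?]]|[? ? ?]] //.
by split=> //; lra.
Qed.

Lemma box_dom x : B x -> D x. Proof. by case. Qed.

Lemma inQ_lin f g f' g' t : inQ f g -> inQ f' g' -> 0 <= t <= 1 ->
  inQ (lin f f' t) (lin g g' t).
Proof.
move=> [/andP[f1 f2] g1 g2] [/andP[f1' f2'] g1' g2'] t01; split.
- by rewrite lin_ge ?lin_le.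
- exact: lin_ge.
- have := max_lin f f' t01; rewrite -(ler_pM2l k_gt0) => h.
  apply: le_trans (lin_le g2 g2' t01).
  have -> : lin (g + k * Num.max f 0) (g' + k * Num.max f' 0) t =
      lin g g' t + k * lin (Num.max f 0) (Num.max f' 0) t by rewrite /lin; ring.
  by rewrite lerD2l.
Qed.

Lemma inQ00 : inQ 0 0.
Proof. by split; rewrite ?maxxx; have := d_gt0; have := d'_gt0; lra. Qed.

Lemma box_O : B O.
Proof. by apply/(box_inQ (mc_dom_O mc)); rewrite FO GlO; exact: inQ00. Qed.

Lemma chart_box x0 W : D x0 -> nbhs x0 W -> exists2 e, 0 < e &
  forall p, `|p.1 - F x0| <= e -> `|p.2 - H x0| <= e ->
    [/\ D (inv p), W (inv p) & c (inv p) = p].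
Proof.
move=> Dx0 Wx0.
have n1 : nbhs (c x0) (c @` D).
  by apply: open_nbhs_nbhs; split; [exact: chart_im_open|exists x0].
have n2 : nbhs (c x0) (inv @^-1` W).
  by apply: (chart_inv_continuous (c := c)); [exists x0|rewrite chart_invK].
have [e /= e0 eP] : nbhs_ball (c x0) ((c @` D) `&` (inv @^-1` W)).
  by apply/nbhs_ballP; exact: filterI.
exists (e / 2); first lra.
move=> p p1 p2; have [] := eP p.
  by split; rewrite /ball /= distrC;
    [apply: le_lt_trans p1 _|apply: le_lt_trans p2 _]; lra.
by move=> [x Dx <-] /=; rewrite chart_invK.
Qed.

(** * Monotonicity of Gl along verticals, and the box in the coordinates (F, Gl) *)

Lemma continuous_gl p : (c @` D) p -> {for p, continuous gl}.
Proof.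
move=> Dp; apply: continuous_comp; first exact: chart_inv_continuous.
by case: Dp => x Dx <-; rewrite chart_invK //; exact: (mc_Gl_continuous mc).
Qed.

Lemma gl_derive (f h : R) : (c @` D) (f, h) -> (f, h) != (0, 0) ->
  derivable (fun t => gl (f, t)) h 1 /\ 0 < derive1 (fun t => gl (f, t)) h.
Proof.
move=> [x Dx cx] fh0.
have xO : x <> O by move=> xO; move: fh0; rewrite -cx xO (mc_O mc) eqxx.
have [dl _ _ lpos] := mc_dH mc Dx xO; rewrite cx in dl lpos.
have e : (fun t : R => t^-1 *: (((fun t => gl (f, t)) \o shift h) (t *: 1) -
             (fun t => gl (f, t)) h)) =
         (fun t : R => t^-1 *: ((gl \o shift (f, h)) (t *: (0, 1)) - gl (f, h))).
  apply/funext => t /=; congr (_ *: (Gl (inv _) - _)).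
  by congr pair; rewrite /= scaler0 add0r.
by rewrite derive1E /derivable /derive e.
Qed.

(** Nothing is known about the derivative at O, so a vertical interval with O inside is cut there,
    and each half is treated by continuity up to its end. *)
Lemma gl_incr (f h1 h2 : R) : h1 < h2 ->
  (forall h, h1 <= h <= h2 -> (c @` D) (f, h)) -> gl (f, h1) < gl (f, h2).
Proof.
have inc a b : a < b -> (forall h, a <= h <= b -> (c @` D) (f, h)) ->
    (forall h, a < h < b -> (f, h) != (0, 0)) -> gl (f, a) < gl (f, b).
  move=> ab Dab nz; pose g t := gl (f, t).
  apply: (@gtr0_derive1_incr _ g a b); rewrite ?lexx //.
  - move=> t; rewrite in_itv /= => tab.
    by have [] := gl_derive (Dab t ltac:(lra)) (nz t tab).
  - move=> t; rewrite in_itv /= => tab.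
    by have [] := gl_derive (Dab t ltac:(lra)) (nz t tab).
  - apply: within_cts => t; rewrite /= in_itv /= => tab.
    apply: (@continuous_comp _ _ _ (fun t => (f, t)) gl); first by cts.
    exact/continuous_gl/Dab.
move=> h12 Dh; have [f0|f0] := eqVneq f 0; last first.
  by apply: inc => // h _; apply: contra_neq f0 => -[].
have nz h : h != 0 -> (f, h) != (0, 0) by apply: contra_neq => -[].
have [h1n|h1p] := ltP h1 0; last first.
  by apply: inc => // h hh; apply: nz; rewrite gt_eqF //; lra.
have [h2p|h2n] := ltP 0 h2; last first.
  by apply: inc => // h hh; apply: nz; rewrite lt_eqF //; lra.
apply: (@lt_trans _ _ (gl (f, 0))).
  apply: inc => // h hh; first by apply: Dh; lra.
  by apply: nz; rewrite lt_eqF //; lra.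
apply: inc => // h hh; first by apply: Dh; lra.
by apply: nz; rewrite gt_eqF //; lra.
Qed.

(** An implicit function theorem that remains valid at O, where Gl need not be differentiable:
    strict monotonicity makes the values at heights [h0 - e] and [h0 + e] bracket [g0], this
    persists for nearby [f], and the intermediate value theorem applies. *)
Lemma Gl_solve x0 W : D x0 -> nbhs x0 W -> exists e1 e2 r,
  [/\ 0 < e1, 0 < e2, 0 < r,
      forall p, `|p.1 - F x0| <= e1 -> `|p.2 - H x0| <= e2 ->
        [/\ D (inv p), W (inv p) & c (inv p) = p] &
      forall f g, `|f - F x0| <= e1 -> `|g - Gl x0| < r ->
        exists2 h, `|h - H x0| <= e2 & gl (f, h) = g].
Proof.
move=> Dx0 Wx0; have [e e0 eP] := chart_box Dx0 Wx0.
set f0 := F x0; set h0 := H x0; set g0 := Gl x0.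
have eD p : `|p.1 - f0| <= e -> `|p.2 - h0| <= e -> (c @` D) p.
  by move=> p1 p2; have [Dp _ cp] := eP p p1 p2; exists (inv p).
have fh0 : c x0 = (f0, h0) by rewrite -surjective_pairing.
have gl0 : gl (f0, h0) = g0 by rewrite /= -fh0 chart_invK.
have ee : `|f0 - f0| <= e by rewrite subrr normr0 ltW.
have l1 : gl (f0, h0 - e) < g0.
  rewrite -gl0; apply: gl_incr => [|h hh]; first lra.
  by apply: eD => //=; rewrite ler_norml; lra.
have l2 : g0 < gl (f0, h0 + e).
  rewrite -gl0; apply: gl_incr => [|h hh]; first lra.
  by apply: eD => //=; rewrite ler_norml; lra.
(* Half the margin is kept for [g]; the other half absorbs the variation of [f]. *)
pose r := Num.min (g0 - gl (f0, h0 - e)) (gl (f0, h0 + e) - g0) / 2.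
have r0 : 0 < r by rewrite divr_gt0 // lt_min !subr_gt0 l1 l2.
have [r1 r2] : gl (f0, h0 - e) < g0 - r /\ g0 + r < gl (f0, h0 + e).
  have : 2 * r <= g0 - gl (f0, h0 - e).
    by rewrite /r mulrC divfK // ge_min lexx.
  have : 2 * r <= gl (f0, h0 + e) - g0.
    by rewrite /r mulrC divfK // ge_min lexx orbT.
  by lra.
have ctf s : `|s - h0| <= e -> {for f0, continuous (fun f => gl (f, s))}.
  move=> hs; apply: (@continuous_comp _ _ _ (fun f => (f, s)) gl); first by cts.
  exact/continuous_gl/eD.
have [e1 /= e10 e1P] : nbhs_ball f0 [set f | gl (f, h0 - e) < g0 - r /\
    g0 + r < gl (f, h0 + e)].
  apply/nbhs_ballP; apply: filterI.
    by apply: (near_lt (f := fun f => gl (f, h0 - e)) _ r1); apply: ctf;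
      rewrite ler_norml; lra.
  by apply: (near_gt (f := fun f => gl (f, h0 + e)) _ r2); apply: ctf;
    rewrite ler_norml; lra.
exists (Num.min e (e1 / 2)), e, r; split=> //.
- by rewrite lt_min e0 divr_gt0.
- by move=> p; rewrite le_min => /andP[p1 _]; exact: eP.
move=> f g; rewrite le_min => /andP[fe fe1] gr.
have [g1 g2] : gl (f, h0 - e) < g0 - r /\ g0 + r < gl (f, h0 + e).
  by apply: e1P; rewrite /ball /= distrC (le_lt_trans fe1) //; lra.
have [|||h hh <-] := @IVT _ (fun h => gl (f, h)) (h0 - e) (h0 + e) g.
- lra.
- apply: within_cts => h; rewrite /= in_itv /= => hh.
  apply: (@continuous_comp _ _ _ (fun t => (f, t)) gl); first by cts.
  by apply: continuous_gl; apply: eD => //=; rewrite ler_norml; lra.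
- by move: gr; rewrite ltr_norml ge_min le_max; lra.
by exists h => //; move: hh; rewrite in_itv /= ler_norml; lra.
Qed.

Lemma inQ_chart p : (c @` B) p -> inQ p.1 (gl p).
Proof.
case=> x Bx <-; have Dx := box_dom Bx.
by rewrite /= chart_invK //; move: Bx => /(box_inQ Dx).
Qed.

Lemma box_chart p : D (inv p) -> c (inv p) = p -> inQ p.1 (gl p) -> (c @` B) p.
Proof.
move=> Dp cp Qp; exists (inv p) => //; apply/(box_inQ Dp).
by rewrite cp.
Qed.

(** For distinct abscissae the strip [K] is the preimage of the segment in the coordinates (F, Gl),
    with [ta] as parameter: it stays in the box because [inQ] is convex, and [Gl_solve] provides a
    point over every abscissa. It need not be a straight line of the surface. On a common vertical,
    monotonicity of Gl keeps the vertical segment in the box. *)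
Lemma box_locally_strip_joined : locally_strip_joined (c @` B).
Proof.
move=> _ [x0 Bx0 <-]; have Dx0 := box_dom Bx0.
have [e1 [e2 [r [e10 e20 r0 good solve]]]] :=
  Gl_solve Dx0 (filterT : nbhs x0 setT).
set f0 := F x0 in good solve *; set h0 := H x0 in good solve *.
set g0 := Gl x0 in solve *.
have cx0 : (c @` D) (c x0) by exists x0.
have gl0 : gl (c x0) = g0 by rewrite /= chart_invK.
exists [set z | [/\ `|z.1 - f0| < e1, `|z.2 - h0| < e2 & `|gl z - g0| < r]].
  have gc : {for c x0, continuous gl} by exact: continuous_gl.
  near=> z; split; near: z.
  - by apply: (near_lt (f := fun z => `|z.1 - f0|)); [cts|rewrite subrr normr0].
  - by apply: (near_lt (f := fun z => `|z.2 - h0|)); [cts|rewrite subrr normr0].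
  - apply: (near_lt (f := fun z => `|gl z - g0|)).
      by apply: cts_norm; apply: ctsD => //; cts.
    by rewrite gl0 subrr normr0.
have mono f a b : `|f - f0| <= e1 -> `|a - h0| <= e2 -> `|b - h0| <= e2 ->
    a < b -> gl (f, a) < gl (f, b).
  move=> fe ae be ab; apply: gl_incr => // h hab.
  have [|Dp _ cp] := good (f, h) fe; last by exists (inv (f, h)).
  by move: ae be; rewrite /= !ler_norml; lra.
have inj f a b : `|f - f0| <= e1 -> `|a - h0| <= e2 -> `|b - h0| <= e2 ->
    gl (f, a) = gl (f, b) -> a = b.
  move=> fe ae be eab; have [ab|ba|//] := ltgtP a b.
    by have := mono _ _ _ fe ae be ab; rewrite eab ltxx.
  by have := mono _ _ _ fe be ae ba; rewrite eab ltxx.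
have wlin (a b m e t : R) : `|a - m| <= e -> `|b - m| <= e -> 0 <= t <= 1 ->
    `|lin a b t - m| <= e.
  rewrite !ler_norml !lerBrDr !lerBlDr => /andP[? ?] /andP[? ?] t01.
  by rewrite lin_ge ?lin_le.
have slin (a b m e t : R) : `|a - m| < e -> `|b - m| < e -> 0 <= t <= 1 ->
    `|lin a b t - m| < e.
  move=> am bm t01; apply: (@le_lt_trans _ _ (Num.max `|a - m| `|b - m|)).
    by apply: wlin => //; rewrite le_max lexx ?orbT.
  by rewrite gt_max am.
move=> x y Bx [x1 x2 x3] By [y1 y2 y3].
have Qx := inQ_chart Bx; have Qy := inQ_chart By.
have [exy|nxy] := eqVneq x.1 y.1.
  exists (segment x y); apply: segment_strip_joined => _ [t t01 <-].
  have {}t01 : 0 <= t <= 1 by move: t01; rewrite /= in_itv.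
  rewrite -exy linaa; set h := lin _ _ _.
  have he : `|h - h0| <= e2 by apply: wlin => //; exact: ltW.
  have [Dp _ cp] := good (x.1, h) (ltW x1) he.
  apply: box_chart => //.
  have le a b : `|a - h0| <= e2 -> `|b - h0| <= e2 -> a <= b ->
      gl (x.1, a) <= gl (x.1, b).
    move=> ae be; rewrite le_eqVlt => /predU1P[->//|ab].
    by apply/ltW/mono => //; exact: ltW.
  move: Qx Qy; rewrite (surjective_pairing x) (surjective_pairing y) -exy.
  move=> [Q1 Q2 Q3] [_ Q4 Q5]; have [xy|yx] := leP x.2 y.2.
    have l1 : gl (x.1, x.2) <= gl (x.1, h).
      by apply: le => //; [exact: ltW|exact: lin_ge].
    have l2 : gl (x.1, h) <= gl (x.1, y.2).
      by apply: le => //; [exact: ltW|exact: lin_le].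
    by split=> //; [exact: le_trans l1|apply: le_trans Q5; rewrite lerD2r].
  have l1 : gl (x.1, y.2) <= gl (x.1, h).
    by apply: le => //; [exact: ltW|apply: lin_ge => //; exact: ltW].
  have l2 : gl (x.1, h) <= gl (x.1, x.2).
    by apply: le => //; [exact: ltW|apply: lin_le => //; exact: ltW].
  by split=> //; [exact: le_trans l1|apply: le_trans Q3; rewrite lerD2r].
pose ta (z : R * R) := (z.1 - x.1) / (y.1 - x.1).
have yx0 : y.1 - x.1 != 0 by rewrite subr_eq0 eq_sym.
have taE z : z.1 = lin x.1 y.1 (ta z) by rewrite /lin /ta divfK // addrC subrK.
have talin t h : ta (lin x.1 y.1 t, h) = t.
  by rewrite /ta /lin /= addrAC subrr add0r mulfK.
pose N : set (R * R) := `[f0 - e1, f0 + e1] `*` `[h0 - e2, h0 + e2].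
have NP z : N z <-> `|z.1 - f0| <= e1 /\ `|z.2 - h0| <= e2.
  by rewrite /N /= !in_itv /= !ler_distl.
pose K := (N `&` [set z | gl z - lin (gl x) (gl y) (ta z) = 0]) `&`
          (ta @^-1` `[0, 1]).
have Nx : N x by apply/NP; rewrite !ltW.
have Ny : N y by apply/NP; rewrite !ltW.
have tax : ta x = 0 by rewrite /ta subrr mul0r.
have tay : ta y = 1 by rewrite /ta divff.
have solK t : 0 <= t <= 1 -> exists h, K (lin x.1 y.1 t, h).
  move=> t01; have [||h he gh] := solve (lin x.1 y.1 t) (lin (gl x) (gl y) t).
  - by apply: wlin => //; exact: ltW.
  - exact: slin.
  exists h; split; last by rewrite /= talin in_itv.
  split; first by apply/NP; split=> //=; apply: wlin => //; exact: ltW.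
  by rewrite /= talin -[Gl _]/(gl _) gh subrr.
have tc z : {for z, continuous ta} by rewrite /ta; cts.
exists K; split; last 1 first.
- move=> _ z [[/NP [zf zh] /eqP]]; rewrite subr_eq0 => /eqP gz _ zx.
  case: z zf zh gz zx => f h /= zf zh gz zx; rewrite zx {f zx} in zf gz *.
  rewrite {1}/ta subrr mul0r lin0 in gz.
  rewrite (surjective_pairing x); congr pair; apply: (inj x.1) => //.
    exact: ltW.
  by rewrite -surjective_pairing.
- split.
  + apply: compact_closedI; last by apply: closed_preimage_cts => //;
    exact: interval_closed.
    apply: compact_level.
    * exact: norm_hausdorff.
    * by apply: compact_setX; exact: segment_compact.
    * move=> z /NP[z1 z2]; apply: ctsD.
        by apply: continuous_gl; have [Dp _ cp] := good z z1 z2; exists (inv z).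
      apply: ctsN; apply: (@continuous_comp _ _ _ ta) => //; exact: cts_lin.
  + move=> z [[/NP[z1 z2] /eqP]]; rewrite subr_eq0 => /eqP gz.
    rewrite /= in_itv /= => t01; have [Dp _ cp] := good z z1 z2.
    by apply: box_chart => //; rewrite gz {1}taE; exact: inQ_lin.
  + move=> _ _ [z [_ z01] <-] [w [_ w01] <-] f fzw.
    rewrite /= !in_itv /= in z01 w01.
    have [s s01 sf] := lin_between fzw.
    pose t := lin (ta z) (ta w) s.
    have fE : f = lin x.1 y.1 t by rewrite /t lin_lin -!taE.
    have [|h Kh] := solK t; first exact: lin_itv.
    by exists (f, h) => //; rewrite fE.
  + move=> f a b h Ka [[/NP[_ /= b2] /eqP]]; rewrite subr_eq0 => /eqP gb _ ahb.
    case: (Ka) => -[/NP[/= f1 a2] /eqP]; rewrite subr_eq0 => /eqP ga _.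
    have ab : a = b by apply: (inj f) => //; exact: etrans ga (esym gb).
    by have -> : h = a by apply/le_anti; rewrite {1}ab andbC.
- by split; [split=> //=;
  rewrite -[Gl _]/(gl x) tax lin0 subrr|rewrite /= tax in_itv /= lexx ler01].
- by split; [split=> //=;
  rewrite -[Gl _]/(gl y) tay lin1 subrr|rewrite /= tay in_itv /= lexx ler01].
Unshelve. all: by end_near.
Qed.

Lemma box_vconvex : vconvex (c @` B).
Proof.
have wc : {within B, continuous c}.
  by apply: within_cts => x /box_dom; exact: chart_map_continuous.
apply: vconvex_of_locally_strip_joined.
- apply: compact_closed; first exact: norm_hausdorff.
  exact: continuous_compact.
- exact: connected_continuous_connected.
- exact: box_locally_strip_joined.
Qed.

(** Connectedness of the slices keeps the whole vertical interval from [x] to [y] in the chart, as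
    [gl_incr] requires. *)
Lemma Gl_mono x y : B x -> B y -> F x = F y -> H x < H y -> Gl x < Gl y.
Proof.
move=> Bx By exy hxy.
rewrite -(chart_invK (box_dom Bx)) -(chart_invK (box_dom By)).
rewrite [c x]surjective_pairing [c y]surjective_pairing -exy.
apply: gl_incr => // h hh.
have [z Bz <-] : (c @` B) (F x, h).
  apply: (box_vconvex _ _ hh); first by rewrite -surjective_pairing; exists x.
  by rewrite exy -surjective_pairing; exists y.
by exists z => //; exact: box_dom.
Qed.

Lemma Gl_inj x y : B x -> B y -> F x = F y -> Gl x = Gl y -> x = y.
Proof.
move=> Bx By ef eg; apply: chart_inj => //; try exact: box_dom.
have [h|h|//] := ltgtP (H x) (H y).
  by have := Gl_mono Bx By ef h; rewrite eg ltxx.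
by have := Gl_mono By Bx (esym ef) h; rewrite eg ltxx.
Qed.

Lemma Gl_le_H x y : B x -> B y -> F x = F y -> (Gl x <= Gl y) = (H x <= H y).
Proof.
move=> Bx By ef; have [h|h|h] := ltgtP (H x) (H y).
- by rewrite ltW // Gl_mono.
- by apply/negbTE; rewrite -ltNge Gl_mono.
- by rewrite (chart_inj (box_dom Bx) (box_dom By) ef h) lexx.
Qed.

Lemma continuous_Gl x : D x -> {for x, continuous Gl}.
Proof. exact: mc_Gl_continuous mc x. Qed.

(** Continuity method along the ray from O to [(f, g)]: the attained parameters form an open set by
    [Gl_solve] and a closed one by compactness of the box. *)
Lemma box_surj f g : inQ f g -> exists x, [/\ B x, F x = f & Gl x = g].
Proof.
move=> Qfg; pose P t := exists x, [/\ B x, F x = t * f & Gl x = t * g].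
have Qt t : t \in `[0, 1] -> inQ (t * f) (t * g).
  rewrite in_itv /= => /(inQ_lin inQ00 Qfg); by rewrite /lin !subr0 !add0r.
have nr (t a e : R) : 0 < e -> \forall s \near t, `|s * a - t * a| < e.
  move=> e0; apply: (near_lt (f := fun s : R => `|s * a - t * a|)); first by cts.
  by rewrite subrr normr0.
suff : `[0, 1]%classic `<=` P.
  move=> /(_ 1); rewrite /P !mul1r; apply.
  by rewrite /= in_itv /= lexx ler01.
apply: (connected_locally_constant (x0 := 0)); first exact: segment_connected.
- by rewrite /= in_itv /= lexx ler01.
- by exists O; split; rewrite ?mul0r ?FO ?GlO //; exact: box_O.
- move=> t t01 [x [Bx xf xg]].
  have [e1 [e2 [r [e10 e20 r0 good solve]]]] :=
    Gl_solve (box_dom Bx) (filterT : nbhs x setT).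
  near=> s => s01; have [||h he gh] := solve (s * f) (s * g).
  + near: s; rewrite xf.
    by apply: filterS (nr t f e1 e10) => s /ltW.
  + near: s; rewrite xg.
    exact: nr.
  have [|Dp _ cp] := good (s * f, h) _ he.
    rewrite /= xf; near: s.
    by apply: filterS (nr t f e1 e10) => s /ltW.
  exists (inv (s * f, h)); split; [|by rewrite cp|by []].
  by apply/(box_inQ Dp); rewrite cp /=; rewrite /= in gh; rewrite gh; exact: Qt.
- move=> t t01 nP; pose X := (fun x => (F x, Gl x)) @` B.
  have clX : closed X.
    apply: compact_closed; first exact: norm_hausdorff.
    apply: continuous_compact => //; apply: within_cts => x /box_dom Dx.
    by apply: cts_pair; [exact: continuous_F|exact: continuous_Gl].
  have PX s : P s <-> X (s * f, s * g).
    split=> [[x [Bx xf xg]]|[x Bx [xf xg]]]; last by exists x.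
    by exists x; rewrite ?xf ?xg.
  have : open ((fun s => (s * f, s * g)) @^-1` (~` X)).
    rewrite -closedC preimage_setC setCK.
    by apply: closed_preimage_cts => // s; cts.
  move=> /(_ t) /=; rewrite -PX => /(_ nP).
  by apply: filterS => s /= nX _ /PX.
Unshelve. all: by end_near.
Qed.

(** Uniform continuity of the inverse of (F, Gl), a continuous injection of a compact set: pairs
    with equal coordinates lie on the diagonal, around which points are close. *)
Lemma box_unif e : 0 < e -> exists2 r, 0 < r & forall x y, B x -> B y ->
  `|F x - F y| < r -> `|Gl x - Gl y| < r -> ball x e y.
Proof.
move=> e0.
have [] := @compact_near_zero R _ (B `*` B)
    (fun u => `|F u.1 - F u.2| + `|Gl u.1 - Gl u.2|) (fun u => ball u.1 e u.2).
- exact: compact_setX.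
- move=> [x y] [/box_dom/= Dx /box_dom/= Dy].
  have cf (f : M -> R) : {for x, continuous f} -> {for y, continuous f} ->
      {for (x, y), continuous (fun u => `|f u.1 - f u.2|)}.
    move=> fx fy; apply: cts_norm; apply: ctsD.
      by apply: (@continuous_comp _ _ _ fst f); [exact: continuous_fst|].
    by apply: ctsN; apply: (@continuous_comp _ _ _ snd f);
      [exact: continuous_snd|].
  apply: ctsD; last by apply: cf; exact: continuous_Gl.
  by apply: (cf (fun x => F x)); exact: continuous_F.
- move=> [x y] [/= Bx By] le0.
  have -> : y = x.
    have := normr_ge0 (F x - F y); have := normr_ge0 (Gl x - Gl y).
    move=> g0 f0; apply/esym/Gl_inj => //.
      by apply/eqP; rewrite -subr_eq0 -normr_eq0; apply/eqP; lra.
    by apply/eqP; rewrite -subr_eq0 -normr_eq0; apply/eqP; lra.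
  have n1 : \forall u \near (x, x), ball x (e / 2) u.1.
    have : {for (x, x), continuous fst} by exact: continuous_fst.
    by apply; apply: nbhsx_ballx; rewrite divr_gt0.
  have n2 : \forall u \near (x, x), ball x (e / 2) u.2.
    have : {for (x, x), continuous snd} by exact: continuous_snd.
    by apply; apply: nbhsx_ballx; rewrite divr_gt0.
  apply: filterS2 n1 n2 => u u1 u2 _.
  by rewrite (splitr e); apply: ball_triangle u2; exact: ball_sym.
move=> r r0 h; exists (r / 2) => [|x y Bx By f1 g1]; first lra.
by apply: (h (x, y)) => //=; lra.
Qed.

(* The two branches Gr and - Gl play symmetric roles: their sum is k F^+, each
   is bounded by d' on the box, and changing the sign of H exchanges them. *)
Definition A (b : bool) x := if b then Gr x else - Gl x.

Lemma GrB x : B x -> Gr x = Gl x + k * Num.max (F x) 0.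
Proof. by move=> /box_dom; exact: GrE. Qed.

Lemma AE x b : D x -> A b x + A (~~ b) x = k * Num.max (F x) 0.
Proof. by move=> Dx; case: b; rewrite /= GrE //; ring. Qed.

Lemma AO b : A b O = 0.
Proof. by case: b; rewrite /= ?GlO ?(mc_Gr_O mc) ?oppr0. Qed.

Lemma continuous_A b x : D x -> {for x, continuous (A b)}.
Proof.
move=> Dx; case: b; first exact: (mc_Gr_continuous mc).
by apply: ctsN; exact: continuous_Gl.
Qed.

(** By [AE] the last expression bounded is the value of the other branch, so both branches are
    described by the same region. *)
Definition inQA (f a : R) :=
  [/\ - d <= f <= d, a <= d' & k * Num.max f 0 - a <= d'].

Lemma box_inQA b x : D x -> B x <-> inQA (F x) (A b x).
Proof.
move=> Dx; rewrite (box_inQ Dx) /inQ /inQA; case: b; rewrite /= ?GrE //.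
  by split=> -[? ? ?]; split=> //; lra.
by split=> -[? ? ?]; split=> //; lra.
Qed.

Lemma inQA_lin f g f' g' t : inQA f g -> inQA f' g' -> 0 <= t <= 1 ->
  inQA (lin f f' t) (lin g g' t).
Proof.
move=> [/andP[f1 f2] g1 g2] [/andP[f1' f2'] g1' g2'] t01; split.
- by rewrite lin_ge ?lin_le.
- exact: lin_le.
- have := max_lin f f' t01; rewrite -(ler_pM2l k_gt0) => h.
  apply: le_trans (lin_le g2 g2' t01).
  have -> : lin (k * Num.max f 0 - g) (k * Num.max f' 0 - g') t =
      k * lin (Num.max f 0) (Num.max f' 0) t - lin g g' t by rewrite /lin; ring.
  by rewrite lerD2r.
Qed.

Lemma A_surj b f a : inQA f a -> exists x, [/\ B x, F x = f & A b x = a].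
Proof.
move=> [fd ad ad']; case: b => /=.
  have [|x [Bx xf xg]] := @box_surj f (a - k * Num.max f 0).
    by split=> //; lra.
  by exists x; split=> //; rewrite (GrE (box_dom Bx)) xf xg; ring.
have [|x [Bx xf xg]] := @box_surj f (- a); first by split=> //; lra.
by exists x; split=> //; rewrite xg opprK.
Qed.

Lemma A_Gl b x y : D x -> D y -> F x = F y -> A b x = A b y -> Gl x = Gl y.
Proof.
move=> Dx Dy ef; case: b => /=; last exact: oppr_inj.
by rewrite !GrE // ef => /addIr.
Qed.

Lemma A_inj b x y : B x -> B y -> F x = F y -> A b x = A b y -> x = y.
Proof.
by move=> Bx By ef ea; apply: Gl_inj => //; apply: A_Gl ea => //; exact: box_dom.
Qed.

Lemma A_H_between b x y z : B x -> B y -> B z -> F x = F z -> F y = F z ->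
  A b x <= A b z <= A b y -> H x <= H z <= H y \/ H y <= H z <= H x.
Proof.
move=> Bx By Bz xz yz; case: b => /=.
  rewrite !GrB // xz yz !lerD2r !Gl_le_H //; first by left.
by rewrite !lerN2 !Gl_le_H //; right; rewrite andbC.
Qed.

Lemma A_unif b e : 0 < e -> exists2 r, 0 < r & forall x y, B x -> B y ->
  `|F x - F y| < r -> `|A b x - A b y| < r -> ball x e y.
Proof.
move=> /box_unif[r r0 rP]; case: b => /=; last first.
  exists r => // x y Bx By f g; apply: rP => //.
  by rewrite (_ : Gl x - Gl y = - (- Gl x - - Gl y)) ?normrN //; ring.
have k1 : 0 < 1 + k by rewrite addr_gt0 // k_gt0.
(* As the positive part is 1-Lipschitz, Gl varies by at most the variation of Gr plus [k] times that
   of F, which this choice keeps below [r]. *)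
exists (r / (1 + k)) => [|x y Bx By f g]; first by rewrite divr_gt0.
have rk : r / (1 + k) <= r.
  by rewrite ler_pdivrMr // ler_peMr ?(ltW r0) // lerDl ltW // k_gt0.
apply: rP => //; first exact: lt_le_trans rk.
move: g; rewrite !GrB //.
set m := Num.max (F x) 0; set m' := Num.max (F y) 0.
have mm : `|m - m'| <= `|F x - F y|.
  rewrite /m /m'; have := ler_norm (F x - F y).
  have := ler_norm (F y - F x); rewrite (distrC (F y)).
  by have [x0|x0] := leP 0 (F x); have [y0|y0] := leP 0 (F y);
    rewrite ?ler_norml; lra.
move=> g; have -> : Gl x - Gl y = (Gl x + k * m - (Gl y + k * m')) - k * (m - m').
  by ring.
apply: le_lt_trans (ler_normB _ _) _.
rewrite normrM (gtr0_norm k_gt0).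
have -> : r = r / (1 + k) + k * (r / (1 + k)) by field; rewrite gt_eqF.
apply: ltr_leD => //; rewrite ler_pM2l ?k_gt0 //.
by apply: le_trans mm _; exact: ltW.
Qed.

(** The domain on which the branch [A b] is affine: the chart domain cut along F = 0 below O for Gr
    and above O for Gl, with O itself removed. *)
Definition U b : set M :=
  [set x | D x /\ (F x = 0 -> if b then 0 < H x else H x < 0)].

Lemma U_open b : open (U b).
Proof.
rewrite openE => x [Dx Fx]; have nD : nbhs x D.
  by apply: open_nbhs_nbhs; split=> //; exact: chart_dom_open.
have [F0|F0] := eqVneq (F x) 0; last first.
  have : \forall y \near x, 0 < `|F y|.
    by apply: near_gt; [exact/cts_norm/continuous_F|rewrite normr_gt0].
  apply: filterS2 nD => y Dy Fy; split=> // Fy0; exfalso.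
  by rewrite Fy0 normr0 ltxx in Fy.
have {Fx} := Fx F0; case: b => Hx.
  have := near_gt (continuous_H Dx) Hx.
  by apply: filterS2 nD.
have := near_lt (continuous_H Dx) Hx.
by apply: filterS2 nD.
Qed.

Lemma A_affine b : aff (sas_sheaf S) (U b) (A b).
Proof.
case: b.
  apply: aff_restrict (mc_Gr_affine mc); [|exact: (U_open true)|].
    suff -> : D `\` [set x | F x = 0 /\ H x <= 0] = U true by exact: U_open.
    apply/seteqP; split=> x [Dx Fx]; split=> //.
      by move=> F0; rewrite ltNge; apply/negP => H0; exact: Fx.
    by move=> [/Fx]; rewrite leNgt => ->.
  move=> x [Dx Fx]; split=> // -[/Fx].
  by rewrite leNgt => ->.
have e : D `\` [set x | F x = 0 /\ 0 <= H x] = U false.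
  apply/seteqP; split=> x [Dx Fx]; split=> //.
    by move=> F0; rewrite ltNge; apply/negP => H0; exact: Fx.
  by move=> [/Fx]; rewrite leNgt => ->.
have := mc_Gl_affine mc; rewrite e => al.
apply: aff_ext (aff_lin (-1) 0 (U_open _) al al); first exact: U_open.
by move=> x _ /=; ring.
Qed.

(** Over F = 0 the branches agree, vanish at O and Gl increases with H, so the sign of [A b] tells
    the side of O. This replaces H by the affine coordinates from here on. *)
Lemma U_pos b x : B x -> (F x = 0 -> 0 < A b x) -> U b x.
Proof.
move=> Bx Fx; split=> [|F0]; first exact: box_dom.
have {Fx} := Fx F0; case: b => /=.
  have := Gl_le_H Bx box_O; rewrite FO GlO HO => /(_ F0) e.
  by rewrite GrB // F0 maxxx mulr0 addr0 !ltNge e.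
have := Gl_le_H box_O Bx; rewrite FO GlO HO => /(_ (esym F0)) e.
by rewrite oppr_gt0 !ltNge e.
Qed.

Lemma U_regular_cover b x : B x -> x <> O -> U b x \/ U (~~ b) x.
Proof.
move=> Bx xO; have [F0|F0] := eqVneq (F x) 0; last first.
  by left; apply: U_pos => // /eqP; rewrite (negbTE F0).
have s0 : A b x + A (~~ b) x = 0 by rewrite (AE b (box_dom Bx)) F0 maxxx mulr0.
have [a0|a0|a0] := ltgtP (A b x) 0.
- by right; apply: U_pos => // _; lra.
- by left; apply: U_pos.
- by case: xO; apply: (@A_inj b) => //; rewrite ?FO ?AO //; exact: box_O.
Qed.

Lemma regular_line_affine I g a b t (h : M -> R) V :
  regular_line S I g -> `[a, b] `<=` I -> a < t < b ->
  open V -> V (g t) -> aff (sas_sheaf S) V h ->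
  exists s s', [/\ a <= s, s < t < s', s' <= b & affine_on s s' (h \o g)].
Proof.
move=> [iI gc greg gaff] abI abt oV Vgt affh.
have It : I t by apply: abI; rewrite /= in_itv /=; lra.
have [c' ac' dc't] : regular S (g t) by apply: greg; exists t.
have [_ _ _ loc] := ac'.
have oW : open (V `&` chart_dom c') by apply: openI oV (chart_dom_open _).
have affW : aff (sas_sheaf S) (V `&` chart_dom c') h.
  by apply: aff_restrict affh => //; exact: subIsetl.
have [a0 [b1 [b2 hE]]] := loc _ _ oW (@subIsetr _ _ _) affW (g t) (conj Vgt dc't).
have nd : nbhs (g t) (chart_dom c').
  by apply: open_nbhs_nbhs; split=> //; exact: chart_dom_open.
have nI : \forall u \near t, I u.
  have : \forall u \near t, u \in `]a, b[ by apply: near_in_itv; rewrite in_itv.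
  apply: filterS => u; rewrite in_itv /= => uab.
  by apply: abI; rewrite /= in_itv /=; lra.
have nN : \forall u \near t, h (g u) = a0 + b1 * (c' (g u)).1 +
    b2 * (c' (g u)).2 /\ chart_dom c' (g u).
  have hd : nbhs (g t) ([set z | h z = a0 + b1 * (c' z).1 + b2 * (c' z).2] `&`
      chart_dom c') by exact: filterI.
  have nW := within_near gc It hd.
  by apply: filterS2 nI nW => u Iu /(_ Iu).
have [s [s' [sa st sb ss]]] := near_subitv abt nN.
exists s, s'; split=> //.
have [|||p [v pv]] := gaff c' ac' s s'.
- by case/andP: st => ? ?; apply: ltW; exact: (@lt_trans _ _ t).
- by move=> u; rewrite /= in_itv /= => us; apply: abI; rewrite /= in_itv /=; lra.
- by move=> _ [u us <-]; move: us; rewrite /= in_itv /= => /ss [].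
exists (a0 + b1 * p.1 + b2 * p.2), (b1 * v.1 + b2 * v.2) => u us.
rewrite /= (ss u us).1 pv //= -![_ *: _]/(_ * _); ring.
Qed.

(** * Straight lines in the box *)

Context (focB : B `&` focus S = [set O]).

Lemma regular_box x : B x -> x <> O -> regular S x.
Proof.
move=> Bx xO; apply: contrapT => nr; apply: xO.
by have : (B `&` focus S) x by []; rewrite focB.
Qed.

Lemma focus_O : focus S O.
Proof. by have : (B `&` focus S) O by [rewrite focB]; case. Qed.

Lemma continuous_along (I : set R) (g : R -> M) (h : M -> R) :
  (forall x, B x -> {for x, continuous h}) -> {within I, continuous g} ->
  g @` I `<=` B -> {within I, continuous (h \o g)}.
Proof.
by move=> hc gc gB; apply: within_comp gc _ => t It; apply/hc/gB; exists t.
Qed.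

Lemma continuous_along_F (I : set R) (g : R -> M) :
  {within I, continuous g} -> g @` I `<=` B ->
  {within I, continuous (fun t => F (g t))}.
Proof.
move=> gc gB; have FcB x : B x -> {for x, continuous (fun x => F x)}.
  by move=> /box_dom; exact: continuous_F.
exact: continuous_along FcB gc gB.
Qed.

Lemma line_unbroken a b g : a <= b -> {within `[a, b], continuous g} ->
  g @` `[a, b] `<=` B -> affine_on a b (fun t => F (g t)) ->
  (forall t, a < t < b ->
    exists e s s', s < t < s' /\ affine_on s s' (A e \o g)) ->
  exists e, affine_on a b (A e \o g).
Proof.
move=> ab gc gB afF loc.
apply: (affine_on_broken ab afF _ _ loc (k := k)) => [e|t tab].
  by apply: continuous_along => // x /box_dom; exact: continuous_A.
have /box_dom Dgt : B (g t) by apply: gB; exists t => //; rewrite /= in_itv.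
exact: (AE true).
Qed.

Lemma regular_line_model a b g : a <= b -> regular_line S `[a, b] g ->
  g @` `[a, b] `<=` B -> affine_on a b (fun t => F (g t)) /\
    exists e, affine_on a b (A e \o g).
Proof.
move=> ab rg gB; have [iI gc greg _] := rg.
have gBt t : a < t < b -> B (g t).
  by move=> tab; apply: gB; exists t => //; rewrite /= in_itv /= !ltW //; lra.
have gO t : a < t < b -> g t <> O.
  move=> tab gtO; apply: focus_O; rewrite -gtO; apply: greg.
  by exists t => //; rewrite /= in_itv /= !ltW //; lra.
have afF : affine_on a b (fun t => F (g t)).
  apply: affine_of_locally_affine => //.
    exact: continuous_along_F.
  move=> t tab; have Dgt := box_dom (gBt t tab).
  have [s [s' [sa st sb af]]] := regular_line_affine (h := fun x => F x) rg
    (@subset_refl _ _) tab (chart_dom_open c) Dgt (mc_F_affine mc).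
  by exists s, s'.
split=> //; apply: line_unbroken => // t tab.
have [e Ue] : exists e, U e (g t).
  by have [?|?] := U_regular_cover true (gBt t tab) (gO t tab);
    [exists true|exists false].
have [s [s' [sa st sb af]]] := regular_line_affine rg
  (@subset_refl _ _) tab (U_open e) Ue (A_affine e).
by exists e, s, s'.
Qed.

(** The approximating lines may use different branches. If the limit is not affine for [A true],
    neither are the late terms, which are therefore all affine for [A false], and so is the
    limit. *)
Lemma limit_line_model s t (g_ : nat -> R -> M) (g : R -> M) : s < t ->
  (forall n, regular_line S `[s, t] (g_ n) /\ g_ n @` `[s, t] `<=` B) ->
  {uniform `[s, t], g_ @ \oo --> g} -> g @` `[s, t] `<=` B ->
  affine_on s t (fun t => F (g t)) /\ exists e, affine_on s t (A e \o g).
Proof.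
move=> st rg gu gB.
have model n := regular_line_model (ltW st) (rg n).1 (rg n).2.
have lim (h : M -> R) u : (forall x, B x -> {for x, continuous h}) ->
    s <= u <= t -> h (g_ n u) @[n --> \oo] --> h (g u).
  move=> hc ust; have Iu : `[s, t]%classic u by rewrite /= in_itv.
  apply: cvg_comp; first exact: uniform_cvg_at gu Iu.
  by apply: hc; apply: gB; exists u.
split.
  have FcB x : B x -> {for x, continuous (fun x => F x)}.
    by move=> /box_dom; exact: continuous_F.
  have limF u : s <= u <= t -> F (g_ n u) @[n --> \oo] --> F (g u).
    exact: lim FcB.
  have nF : \forall n \near \oo, affine_on s t (fun t => F (g_ n t)).
    by near=> n; have [] := model n.
  exact: affine_on_lim st nF limF.
have [afT|nafT] := pselect (affine_on s t (A true \o g)); first by exists true.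
exists false; apply: (@affine_on_lim _ _ _ (fun n => A false \o g_ n)) => //;
  last first.
  by move=> u ust; apply: lim => // x /box_dom; exact: continuous_A.
(* A time at which the relation of [affine_onP] fails for the limit, hence also for all late
   terms. *)
have [u [ust neq]] : exists u, s <= u <= t /\
    (A true (g u) - A true (g s)) * (t - s) -
    (u - s) * (A true (g t) - A true (g s)) != 0.
  apply: contrapT => none; apply: nafT; apply/affine_onP => // u ust.
  apply/eqP; rewrite -subr_eq0; apply: contrapT => /negP nz.
  by apply: none; exists u.
have limA v : s <= v <= t -> A true (g_ n v) @[n --> \oo] --> A true (g v).
  by move=> vst; apply: lim => // x /box_dom; exact: continuous_A.
have [ss tt] : s <= s <= t /\ s <= t <= t by rewrite !lexx (ltW st).
have l : `|(A true (g_ n u) - A true (g_ n s)) * (t - s) -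
    (u - s) * (A true (g_ n t) - A true (g_ n s))| @[n --> \oo] -->
    `|(A true (g u) - A true (g s)) * (t - s) -
    (u - s) * (A true (g t) - A true (g s))|.
  apply: cvg_norm; apply: cvgB; apply: cvgM; try exact: cvg_cst;
    by apply: cvgB; exact: limA.
have := @cvgr_gt _ _ _ _ _ _ l 0.
rewrite normr_gt0 => /(_ _ neq); apply: filterS => n.
have [_ [[] //]] := model n.
move=> /(affine_onP _ st) /(_ u ust) /= ->.
by rewrite subrr normr0 ltxx.
Unshelve. all: by end_near.
Qed.

(** A singular line is a limit of regular lines only locally, with a branch that may change from one
    time to another; [line_unbroken] selects one branch for the whole interval. *)
Theorem straight_line_model a b g : a < b -> straight_line S B `[a, b] g ->
  affine_on a b (fun t => F (g t)) /\ exists e, affine_on a b (A e \o g).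
Proof.
move=> ab [[rg gB]|[iI [gc gB] _ _ loc]].
  by apply: regular_line_model => //; exact: ltW.
have {}loc t : a < t < b -> exists s s', [/\ s < t < s',
    affine_on s s' (fun t => F (g t)) & exists e, affine_on s s' (A e \o g)].
  move=> tab; have [|s [s' [st ssI [g_ [rg gu]]]]] := loc t.
    by rewrite interior_itv_bnd /= in_itv.
  have ss : s < s' by lra.
  have gBs : g @` `[s, s'] `<=` B.
    by apply: subset_trans gB; exact: image_subset.
  by exists s, s'; have [] := limit_line_model ss rg gu gBs.
have afF : affine_on a b (fun t => F (g t)).
  apply: affine_of_locally_affine => //; first exact: ltW.
    exact: continuous_along_F.
  by move=> t /loc [s [s' [? ? _]]]; exists s, s'.
split=> //; apply: line_unbroken => //; first exact: ltW.
by move=> t /loc [s [s' [? _ [e ?]]]]; exists e, s, s'.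
Qed.

(** Unlike [Gl_inj], this holds at all points of the chart domain: affine charts around a boundary
    point of the box leave the box. *)
Lemma locally_inj y : D y -> exists2 N, nbhs y N & forall z w, N z -> N w ->
  F z = F w -> Gl z = Gl w -> z = w.
Proof.
move=> Dy; have [e e0 eP] := chart_box Dy (filterT : nbhs y setT).
exists [set z | [/\ D z, `|F z - F y| < e & `|H z - H y| < e]].
  have nD : nbhs y D by apply: open_nbhs_nbhs; split=> //; exact: chart_dom_open.
  have nF : \forall z \near y, `|F z - F y| < e.
    apply: near_lt; last by rewrite subrr normr0.
    by apply: cts_norm; apply: ctsD; [exact: continuous_F|cts].
  have nH : \forall z \near y, `|H z - H y| < e.
    apply: near_lt; last by rewrite subrr normr0.
    by apply: cts_norm; apply: ctsD; [exact: continuous_H|cts].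
  by apply: filterS3 nD nF nH.
have lt z w : D z -> D w -> `|F z - F y| < e -> `|H z - H y| < e ->
    `|H w - H y| < e -> F z = F w -> H z < H w -> Gl z < Gl w.
  move=> Dz Dw fz hz hw ef hzw; rewrite -(chart_invK Dz) -(chart_invK Dw).
  rewrite [c z]surjective_pairing [c w]surjective_pairing -ef.
  apply: gl_incr => // h hh; have [||Dp _ cp] := eP (F z, h).
  - exact: ltW.
  - by move: hz hw; rewrite /= !ltr_distl ler_distl; lra.
  - by exists (inv (F z, h)).
move=> z w [Dz fz hz] [Dw fw hw] ef eg; apply: chart_inj => //.
have [h|h|//] := ltgtP (H z) (H w).
  by have := lt z w Dz Dw fz hz hw ef h; rewrite eg ltxx.
by have := lt w z Dw Dz fw hw hz (esym ef) h; rewrite eg ltxx.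
Qed.

(** F and [A e] are affine in the chart [c']. Were their linear parts dependent, both would be
    constant along a direction [v] in the chart, against [locally_inj]. So the linear system can be
    inverted. *)
Lemma affine_chart_F_A c' e y : affine_chart (sas_sheaf S) c' ->
  chart_dom c' y -> U e y -> exists a1 p1 q1 a2 p2 q2 : R,
    \forall z \near y, (c' z).1 = a1 + p1 * F z + q1 * A e z /\
                       (c' z).2 = a2 + p2 * F z + q2 * A e z.
Proof.
move=> [_ _ _ loc] dy Uy; have Dy : D y by case: Uy.
have oW : open (U e `&` chart_dom c')
  by apply: openI (U_open e) (chart_dom_open _).
have sW : U e `&` chart_dom c' `<=` chart_dom c' by exact: subIsetr.
have affF : aff (sas_sheaf S) (U e `&` chart_dom c') (fun x => F x).
  apply: aff_restrict (mc_F_affine mc) => //; first exact: chart_dom_open.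
  by move=> z [[]].
have affA : aff (sas_sheaf S) (U e `&` chart_dom c') (A e).
  by apply: aff_restrict (A_affine e) => //; exact: U_open.
have [a [b1 [b2 Fl]]] := loc _ _ oW sW affF y (conj Uy dy).
have [a' [b1' [b2' Al]]] := loc _ _ oW sW affA y (conj Uy dy).
have det : b1 * b2' - b2 * b1' != 0.
  apply/eqP => /eqP; rewrite subr_eq0 => /eqP /degenerate_pair[v [v0 v1 v2]].
  have [N nN Ninj] := locally_inj Dy.
  pose q s : R * R := c' y + s *: v.
  have q0 : q 0 = c' y by rewrite /q scale0r addr0.
  have qc : {for 0, continuous q}.
    have -> : q = (fun s => ((c' y).1 + s * v.1, (c' y).2 + s * v.2)) by [].
    by cts.
  have im0 : (c' @` chart_dom c') (q 0) by exists y.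
  have nim : nbhs (q 0) (c' @` chart_dom c').
    by apply: open_nbhs_nbhs; split=> //; exact: chart_im_open.
  have inv0 : chart_inv c' (q 0) = y by rewrite q0 chart_invK.
  have nd : nbhs y D by apply: open_nbhs_nbhs; split=> //; exact: chart_dom_open.
  have nall : nbhs y (N `&` D `&`
    [set z | F z = a + b1 * (c' z).1 + b2 * (c' z).2]
      `&` [set z | A e z = a' + b1' * (c' z).1 + b2' * (c' z).2]).
    by do !apply: filterI.
  have ninv : nbhs (q 0) (chart_inv c' @^-1` (N `&` D `&`
      [set z | F z = a + b1 * (c' z).1 + b2 * (c' z).2]
      `&` [set z | A e z = a' + b1' * (c' z).1 + b2' * (c' z).2])).
    by apply: chart_inv_continuous => //; rewrite inv0.
  have ns : nbhs (0 :
    R) (q @^-1` ((c' @` chart_dom c') `&` (chart_inv c' @^-1` (N `&` D `&`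
      [set z | F z = a + b1 * (c' z).1 + b2 * (c' z).2]
      `&` [set z | A e z = a' + b1' * (c' z).1 + b2' * (c' z).2])))).
    by apply: qc; exact: filterI.
  have /nbhs_ballP[r /= r0 rP] := ns.
  have r2 : r / 2 != 0 by rewrite gt_eqF // divr_gt0.
  have [|im [[[Nz Dz] /= Fz] Az]] := rP (r / 2).
    rewrite /ball /= sub0r normrN gtr0_norm ?divr_gt0 //; lra.
  have [[[Ny _] /= Fy] Ay] := nbhs_singleton nall.
  set z := chart_inv c' (q (r / 2)) in Nz Dz Fz Az *.
  have cz : c' z = q (r / 2) by case: im => x dx qx; rewrite /z -qx chart_invK.
  have comb (a0 p1 p2 m n s : R) : p1 * v.1 + p2 * v.2 = 0 ->
      a0 + p1 * (m + s * v.1) + p2 * (n + s * v.2) = a0 + p1 * m + p2 * n.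
    move=> pv; have -> : a0 + p1 * (m + s * v.1) + p2 * (n + s * v.2) =
      a0 + p1 * m + p2 * n + s * (p1 * v.1 + p2 * v.2) by ring.
    by rewrite pv mulr0 addr0.
  have Fzy : F z = F y.
    rewrite Fz Fy cz /q /= -![_ *: _]/(_ * _).
    exact: comb.
  have Azy : A e z = A e y.
    rewrite Az Ay cz /q /= -![_ *: _]/(_ * _).
    exact: comb.
  have zy : z = y by apply: Ninj => //; exact: A_Gl Azy.
  move: cz; rewrite zy /q => /eqP; rewrite eq_sym -subr_eq0 addrAC subrr add0r.
  by rewrite scaler_eq0 (negbTE r2) => /eqP /v0.
(* The coefficients are given by Cramer's rule. *)
set dt := b1 * b2' - b2 * b1' in det.
exists ((b2 * a' - b2' * a) / dt), (b2' / dt), (- b2 / dt).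
exists ((b1' * a - b1 * a') / dt), (- b1' / dt), (b1 / dt).
apply: filterS2 Fl Al => z -> ->; rewrite /dt in det *.
by split; field.
Qed.

(** By [affine_chart_F_A] the components in any affine chart are locally affine in time, hence
    affine. The branch may depend on the time: each point is examined with one whose domain contains
    it. *)
Lemma regular_line_of_affine (a b : R) (g : R -> M) :
  {within `[a, b], continuous g} ->
  (forall t, a <= t <= b -> B (g t) /\ g t <> O) ->
  affine_on a b (fun t => F (g t)) ->
  (forall t, a <= t <= b -> exists e, affine_on a b (A e \o g) /\ U e (g t)) ->
  regular_line S `[a, b] g.
Proof.
move=> gc gB afF loc; split=> //; first exact: interval_is_interval.
  move=> _ [t tab <-]; rewrite /= in_itv /= in tab.
  by have [? ?] := gB t tab; exact: regular_box.
move=> c' ac' s t st stI gst.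
have sub u : s <= u <= t -> a <= u <= b.
  by move=> su; have := stI u; rewrite /= !in_itv /=; exact.
have dc u : s <= u <= t -> chart_dom c' (g u).
  by move=> su; apply: gst; exists u => //; rewrite /= in_itv.
have gst' : {within `[s, t], continuous g} by exact: continuous_subspaceW gc.
have c'c : {within `[s, t], continuous (c' \o g)}.
  apply: within_comp gst' _ => u; rewrite /= in_itv /= => /dc.
  exact: chart_map_continuous.
have key u : s < u < t -> exists r r', r < u < r' /\
    affine_on r r' (fun u => (c' (g u)).1) /\
      affine_on r r' (fun u => (c' (g u)).2).
  move=> sut; have su : s <= u <= t by lra.
  have [e [afA Ue]] := loc u (sub u su).
  have [a1 [p1 [q1 [a2 [p2 [q2 nz]]]]]] := affine_chart_F_A ac' (dc u su) Ue.
  have Iu : `[s, t]%classic u by rewrite /= in_itv.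
  have nI := within_near gst' Iu nz.
  have [r [r' [sr ru rt rr]]] := near_subitv sut nI.
  have rr' v : r <= v <= r' -> a <= v <= b /\
      ((c' (g v)).1 = a1 + p1 * F (g v) + q1 * A e (g v) /\
       (c' (g v)).2 = a2 + p2 * F (g v) + q2 * A e (g v)).
    move=> vr; have sv : s <= v <= t by lra.
    by split; [exact: sub|apply: rr => //; rewrite /= in_itv].
  have afFr : affine_on r r' (fun t => F (g t)).
    have [p [q h]] := afF; exists p, q => v vr; apply: h.
    by have [] := rr' v vr.
  have afAr : affine_on r r' (A e \o g).
    have [p [q h]] := afA; exists p, q => v vr; apply: h.
    by have [] := rr' v vr.
  exists r, r'; split=> //; split.
    apply: affine_on_ext (affine_on_comb a1 p1 q1 afFr afAr) => v vr /=.
    by have [_ [-> _]] := rr' v vr.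
  apply: affine_on_ext (affine_on_comb a2 p2 q2 afFr afAr) => v vr /=.
  by have [_ [_ ->]] := rr' v vr.
have c1 : {within `[s, t], continuous (fun u => (c' (g u)).1)}.
  apply: (within_comp (h := fst) c'c) => u _; exact: continuous_fst.
have c2 : {within `[s, t], continuous (fun u => (c' (g u)).2)}.
  apply: (within_comp (h := snd) c'c) => u _; exact: continuous_snd.
have [|p [v h]] := affine_of_locally_affine st c1.
  by move=> u /key[r [r' [? [? _]]]]; exists r, r'.
have [|p' [v' h']] := affine_of_locally_affine st c2.
  by move=> u /key[r [r' [? [_ ?]]]]; exists r, r'.
exists (p, p'), (v, v') => u su.
rewrite [LHS]surjective_pairing h // h' //.
by rewrite (mulrC v) (mulrC v').
Qed.

(** * Lines with prescribed affine coordinates *)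

Definition model_line e s s' (g : R -> M) (p q p' q' : R) :=
  forall t, s <= t <= s' ->
    [/\ B (g t), F (g t) = p + q * t & A e (g t) = p' + q' * t].

Lemma model_line_exists e s s' p q p' q' :
  (forall t, s <= t <= s' -> inQA (p + q * t) (p' + q' * t)) ->
  exists g, model_line e s s' g p q p' q'.
Proof.
move=> Q; have /choice[g gP] : forall t, exists x, s <= t <= s' ->
    [/\ B x, F x = p + q * t & A e x = p' + q' * t].
  move=> t; have [ts|ts] := boolP (s <= t <= s'); last by exists O.
  by have [x xP] := A_surj e (Q t ts); exists x.
by exists g.
Qed.

(** The points of [g] may have been chosen one at a time; continuity comes from the uniform
    continuity of the inverse coordinates. *)
Lemma model_line_cts e s s' g p q p' q' : model_line e s s' g p q p' q' ->
  {within `[s, s'], continuous g}.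
Proof.
move=> gP; apply/subspace_continuousP => t ts W.
move=> /nbhs_ballP[r /= r0 rW]; have [r' r'0 rP] := A_unif e r0.
rewrite /= in_itv /= in ts; have [Bt Ft At] := gP t ts.
have nr (m : R) : \forall u \near t, `|m * t - m * u| < r'.
  apply: (near_lt (f := fun u : R => `|m * t - m * u|)); first by cts.
  by rewrite subrr normr0.
have : \forall u \near t, `[s, s']%classic u -> W (g u).
  apply: filterS2 (nr q) (nr q') => u h1 h2; rewrite /= in_itv /= => us.
  have [Bu Fu Au] := gP u us; apply: rW; apply: rP => //.
    by rewrite Ft Fu opprD addrACA subrr add0r.
  by rewrite At Au opprD addrACA subrr add0r.
exact.
Qed.

Lemma model_line_regular e s s' g p q p' q' : model_line e s s' g p q p' q' ->
  (forall t, s <= t <= s' -> p + q * t = 0 -> 0 < p' + q' * t) ->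
  regular_line S `[s, s'] g /\ g @` `[s, s'] `<=` B.
Proof.
move=> gP pos; split; last first.
  by move=> _ [t ts <-]; rewrite /= in_itv /= in ts; have [] := gP t ts.
apply: regular_line_of_affine.
- exact: model_line_cts gP.
- move=> t ts; have [Bt Ft At] := gP t ts; split=> // gtO.
  have := pos t ts; rewrite -Ft -At gtO FO AO => /(_ erefl).
  by rewrite ltxx.
- by apply: (@affine_on_pq _ p q) => t ts; have [] := gP t ts.
- move=> t ts; have [Bt Ft At] := gP t ts; exists e; split.
    by apply: (@affine_on_pq _ p' q') => u us; have [] := gP u us.
  by apply: U_pos => //; rewrite Ft At; exact: pos.
Qed.

(* Near a passage through O a line is the limit of its translates which avoid
   O on the side where the branch e is affine. *)
Lemma singular_limit e s s' t0 g p q p' q' : s < t0 < s' -> g t0 = O ->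
  model_line e s s' g p q p' q' ->
  exists r r' : R, [/\ r < t0 < r', s <= r /\ r' <= s' &
    exists g_ : nat -> R -> M,
      (forall n, regular_line S `[r, r'] (g_ n) /\ g_ n @` `[r, r'] `<=` B) /\
      {uniform `[r, r'], g_ @ \oo --> g}].
Proof.
move=> st gO gP; have st' : s <= t0 <= s' by lra.
have [_ F0 A0] := gP t0 st'; rewrite gO FO in F0; rewrite gO AO in A0.
(* On the interval chosen below, both coordinates of [g] and all the shifts are at most [m] in
   absolute value. With [2 * m <= d] and [2 * m * (1 + k) <= d'] the shifted lines stay in the
   box. *)
pose m := Num.min d (d' / (1 + k)) / 2.
have k1 : 0 < 1 + k by rewrite addr_gt0 // k_gt0.
have m0 : 0 < m by rewrite divr_gt0 // lt_min d_gt0 divr_gt0 ?d'_gt0.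
have m1 : 2 * m <= d by rewrite /m mulrC divfK // ge_min lexx.
have m2 : 2 * m * (1 + k) <= d'.
  by rewrite -ler_pdivlMr // /m mulrC divfK // ge_min lexx orbT.
have nr (a b : R) : 0 = a + b * t0 -> \forall t \near t0, `|a + b * t| < m.
  move=> ab; apply: (near_lt (f := fun t : R => `|a + b * t|)); first by cts.
  by rewrite -ab normr0.
have [r [r' [sr rt rs rr]]] := near_subitv st (filterI (nr _ _ F0) (nr _ _ A0)).
exists r, r'; split=> //.
(* If [q = 0] the line lies in F = 0 and is shifted off it, to F < 0. Otherwise it crosses F = 0
   only at [t0], and raising [A e] makes the crossing value positive. *)
pose w1 : R := if q == 0 then 1 else 0; pose w2 : R := if q == 0 then 0 else 1.
pose ep (n : nat) := m * n.+1%:R^-1.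
have ep0 n : 0 < ep n by rewrite mulr_gt0 // invr_gt0 ltr0n.
have epm n : ep n <= m.
  by rewrite /ep ler_piMr ?(ltW m0) // invf_le1 ?ltr0n // ler1n.
have wb : 0 <= w1 <= 1 /\ 0 <= w2 <= 1.
  by rewrite /w1 /w2; case: ifP; rewrite !lexx ?ler01.
have epw n w : 0 <= w <= 1 -> 0 <= ep n * w <= m.
  move=> /andP[w0 w1']; rewrite mulr_ge0 ?(ltW (ep0 n)) //=.
  by apply: le_trans (epm n); rewrite ler_piMr // ltW.
have /choice[g_ g_P] : forall n, exists h : R -> M,
    model_line e r r' h (p - ep n * w1) q (p' + ep n * w2) q'.
  move=> n; apply: model_line_exists => t tr.
  have [] := rr t tr; rewrite /= !ltr_norml => h1 h2.
  have e1 := epw n _ wb.1; have e2 := epw n _ wb.2.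
  have mx : Num.max (p - ep n * w1 + q * t) 0 <= 2 * m.
    by rewrite ge_max; lra.
  have mk : 0 <= k * (2 * m) by apply: mulr_ge0; [exact: ltW k_gt0|lra].
  have {}m2 : 2 * m + k * (2 * m) <= d'
    by rewrite (mulrC k) -{1}[2 * m]mulr1 -mulrDr.
  have mx' := ler_wpM2l (ltW k_gt0) mx.
  by split; lra.
exists g_; split=> [n|].
  apply: (model_line_regular (g_P n)) => t tr.
  rewrite /w1 /w2; case: eqP => q0.
    move: F0; rewrite q0 !mul0r !addr0 => <-; rewrite mulr1 sub0r => /eqP.
    by rewrite oppr_eq0 gt_eqF.
  rewrite mulr0 subr0 mulr1 => Ft; have -> : t = t0.
    apply: (mulfI (x := q)); first exact/eqP.
    by apply: (addrI p); rewrite Ft.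
  by rewrite addrAC -A0 add0r.
apply/uniform_ballP => e0 e00; have [z z0 zP] := A_unif e e00.
have epc : \forall n \near \oo, ep n < z.
  have c0 : ep n @[n --> \oo] --> m * 0.
    by apply: cvgM; [exact: cvg_cst|exact: cvg_harmonic].
  by apply: (cvgr_lt _ c0); rewrite mulr0.
apply: filterS epc => n nz t; rewrite /= in_itv /= => tr.
have [Bn Fn An] := g_P n t tr.
have [|Bg Fg Ag] := gP t; first lra.
have e1 := epw n _ wb.1; have e2 := epw n _ wb.2.
have wz w : 0 <= w <= 1 -> `|ep n * w| < z.
  move=> w01; have /andP[ew0 _] := epw n w w01; rewrite ger0_norm //.
  by apply: le_lt_trans nz; rewrite ler_piMr ?(ltW (ep0 n)) //; case/andP: w01.
apply: zP => //.
  rewrite Fg Fn;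
    have -> : p + q * t - (p - ep n * w1 + q * t) = ep n * w1 by ring.
  exact: wz wb.1.
rewrite Ag An; have -> : p' + q' * t - (p' + ep n * w2 + q' * t) = - (ep n * w2).
  by ring.
by rewrite normrN; exact: wz wb.2.
Qed.

(* The segment from x to y in the branch b is a straight line: if it crosses
   F = 0, it does so on the side where b is affine (or at O). *)
Definition crosses_well b x y := 0 <= F x * F y \/
  forall t, 0 <= t <= 1 -> lin (F x) (F y) t = 0 -> 0 <= lin (A b x) (A b y) t.

(** When F keeps its sign, F^+ is affine along the segment, so the segments of the two branches
    coincide. *)
Lemma A_lin_flip b x y z t : B x -> B y -> B z -> 0 <= F x * F y -> 0 <= t <= 1 ->
  F z = lin (F x) (F y) t -> A b z = lin (A b x) (A b y) t ->
  A (~~ b) z = lin (A (~~ b) x) (A (~~ b) y) t.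
Proof.
move=> Bx By Bz fxy t01 Fz Az.
have flip w : B w -> A (~~ b) w = k * Num.max (F w) 0 - A b w.
  by move=> /box_dom/(AE b) <-; rewrite addrC addKr.
rewrite !flip // Fz max_lin_same_sign // Az /lin; ring.
Qed.

Theorem line_exists b x y : B x -> B y -> x <> y -> crosses_well b x y ->
  exists g, line_joining S B x y 0 1 g /\ forall t, 0 <= t <= 1 ->
    [/\ B (g t), F (g t) = lin (F x) (F y) t & A b (g t) = lin (A b x) (A b y) t].
Proof.
move=> Bx By xy good.
have Dx := box_dom Bx; have Dy := box_dom By.
have linE (m n t : R) : lin m n t = m + (n - m) * t by rewrite /lin mulrC.
have [t ht|g gP] :=
  @model_line_exists b 0 1 (F x) (F y - F x) (A b x) (A b y - A b x).
  by rewrite -!linE; apply: inQA_lin => //; exact/box_inQA.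
have gl t : 0 <= t <= 1 ->
    [/\ B (g t), F (g t) = lin (F x) (F y) t & A b (g t) = lin (A b x) (A b y) t].
  by move=> /gP; rewrite !linE.
exists g; split=> //.
have i0 : 0 <= (0 : R) <= 1 by rewrite lexx ler01.
have i1 : 0 <= (1 : R) <= 1 by rewrite lexx ler01.
have g0 : g 0 = x.
  by have [B0 F0 A0] := gl 0 i0; apply: (@A_inj b); rewrite ?F0 ?A0 ?lin0.
have g1 : g 1 = y.
  by have [B1 F1 A1] := gl 1 i1; apply: (@A_inj b); rewrite ?F1 ?A1 ?lin1.
have gc : {within `[0, 1], continuous g} := model_line_cts gP.
have gB : g @` `[0, 1] `<=` B.
  by move=> _ [t t01 <-]; rewrite /= in_itv /= in t01; have [] := gP t t01.
(* A negative value of [A b] over F = 0 can occur only when F keeps its sign, and then the same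
   curve is a segment of the other branch, whose value there is positive. *)
have branch t : 0 <= t <= 1 -> exists e p' q',
    model_line e 0 1 g (F x) (F y - F x) p' q' /\ (F (g t) = 0 -> 0 <= A e (g t)).
  move=> t01; have [Bt Ft At] := gl t t01.
  have [pos|npos] := pselect (F (g t) = 0 -> 0 <= A b (g t)).
    by exists b, (A b x), (A b y - A b x).
  have [Ft0 Aneg] : F (g t) = 0 /\ A b (g t) < 0.
    by move/not_implyP: npos => [? /negP]; rewrite -ltNge.
  case: good => [same|/(_ t t01)]; last first.
    by rewrite -Ft -At Ft0 => /(_ erefl); rewrite leNgt Aneg.
  exists (~~ b), (A (~~ b) x), (A (~~ b) y - A (~~ b) x); split=> [s s01|_].
    have [Bs Fs As] := gl s s01; split=> //; rewrite -!linE //.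
    exact: A_lin_flip.
  have := AE b (box_dom Bt); rewrite Ft0 maxxx mulr0; lra.
split=> //.
have inj s t : 0 <= s <= 1 -> 0 <= t <= 1 -> g s = g t -> s = t.
  move=> s01 t01 gst; apply: contrapT => /eqP st; apply: xy.
  have [_ Fs As] := gP s s01; have [_ Ft At] := gP t t01.
  rewrite gst in Fs As.
  have z (p q : R) : p + q * s = p + q * t -> q = 0.
    move=> /addrI e; apply/eqP; move/eqP: e.
    by rewrite -subr_eq0 -mulrBr mulf_eq0 subr_eq0 (negbTE st) orbF.
  have /eqP := z _ _ (etrans (esym Fs) Ft); rewrite subr_eq0 => /eqP ef.
  have /eqP := z _ _ (etrans (esym As) At); rewrite subr_eq0 => /eqP ea.
  exact: (@A_inj b).
have reg s s' : 0 <= s -> s' <= 1 -> (forall t, s <= t <= s' -> g t <> O) ->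
    regular_line S `[s, s'] g.
  move=> s0 s1 gO.
  have sub t : s <= t <= s' -> 0 <= t <= 1 by move=> ?; lra.
  apply: regular_line_of_affine.
  - apply: continuous_subspaceW gc => t; rewrite /= !in_itv /=; exact: sub.
  - by move=> t ts; split; [have [] := gP t (sub t ts)|exact: gO].
  - apply: (@affine_on_pq _ (F x) (F y - F x)) => t /sub ts.
    by have [] := gP t ts.
  - move=> t ts; have [e [p' [q' [ml pos]]]] := branch t (sub t ts).
    exists e; split.
      by apply: (@affine_on_pq _ p' q') => u /sub us; have [] := ml u us.
    have [Bt _ _] := gP t (sub t ts).
    apply: U_pos => // Ft0; rewrite lt_neqAle pos // andbT eq_sym.
    apply/eqP => At0; apply: (gO t ts); apply: (@A_inj e) => //.
    + exact: box_O.
    + by rewrite FO.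
    + by rewrite AO.
have [[t1 t101 gt1]|none] := pselect (exists2 t1, 0 <= t1 <= 1 & g t1 = O);
  last first.
  by left; split=> //; apply: reg => // t t01 gtO; apply: none; exists t.
right; split=> //.
- exact: interval_is_interval.
- exists 0, 1; split; rewrite ?g0 ?g1 //= in_itv //=.
- exists t1; first by rewrite /= in_itv.
  by rewrite gt1; exact: focus_O.
- move=> t0; rewrite interior_itv_bnd /= in_itv /= => t001.
  have t001' : 0 <= t0 <= 1 by lra.
  have [t01|t01] := eqVneq t0 t1.
    have gt0 : g t0 = O by rewrite t01.
    have [e [p' [q' [ml _]]]] := branch t0 t001'.
    have [r [r' [rt [r0 r1] [g_ gg]]]] := singular_limit t001 gt0 ml.
    exists r, r'; split=> //; last by exists g_.
    by move=> u; rewrite /= !in_itv /= => ru; lra.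
  have ne : \forall u \near t0, u != t1.
    have : \forall u \near t0, 0 < `|u - t1|.
      apply: (near_gt (f := fun u : R => `|u - t1|)); first by cts.
      by rewrite normr_gt0 subr_eq0.
    by apply: filterS => u; rewrite normr_gt0 subr_eq0.
  have [s [s' [s0 st s1 sne]]] := near_subitv t001 ne.
  have sub : `[s, s'] `<=` `[0, 1] by move=> u; rewrite /= !in_itv /= => ru; lra.
  (* Away from the time [t1] of passage through O, which is unique by injectivity, [g] is regular
     and is the limit of a constant sequence. *)
  exists s, s'; split=> //; exists (fun=> g); split; last first.
    by apply/uniform_ballP => e e0; apply: nearW => n t _; exact: ballxx.
  move=> _; split; last by apply: subset_trans gB; exact: image_subset.
  apply: reg => // t ts gtO; have /eqP := sne t ts; apply; apply: inj => //;
    first lra.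
  by rewrite gtO.
Qed.

(** * Locally convex subsets of the box *)

Section LocallyConvexSubset.
Context (C : set M) (subCB : C `<=` B) (closedC : closed C) (conC : connected C).
Context (slcC : strongly_locally_convex S B C).

Lemma strongly_convex_nbhs p : C p -> exists2 W, nbhs p W &
  strongly_convex_in S B (B `&` W) (C `&` W).
Proof.
move=> Cp; have [|V [VB Vp sc]] := slcC Cp (U := B); first exact: nearW.
exists [set z | B z -> V z] => //.
have e1 : B `&` [set z | B z -> V z] = V.
  by apply/seteqP; split=> z; [case=> Bz; exact|move=> Vz; split=> //;
    have [] := VB z Vz].
have e2 : C `&` [set z | B z -> V z] = C `&` V.
  apply/seteqP; split=> z [Cz]; last by move=> Vz; split.
  by move=> /(_ (subCB Cz)).
by rewrite e1 e2.
Qed.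

(** F is affine along the line. If its slope is nonzero, each slice of the image is a point; if it
    is zero, the image lies in one vertical and is convex there by the intermediate value theorem
    for H. *)
Lemma line_strip_joined x y a b g (Y : set M) : Y `<=` B ->
  line_joining S B x y a b g -> g @` `[a, b] `<=` Y ->
  strip_joined (c @` Y) ((c \o g) @` `[a, b]) (c x) (c y).
Proof.
move=> YB [ab sl ga gb] gY; have gB := subset_trans gY YB.
have [[p [q Fg]] _] := straight_line_model ab sl.
have gc : {within `[a, b], continuous g} by case: sl => [[[]]|[_ []]].
have cgc : {within `[a, b], continuous (c \o g)}.
  apply: within_comp gc _ => t tab; apply: chart_map_continuous.
  by apply: box_dom; apply: gB; exists t.
have Hgc : {within `[a, b], continuous (fun t => H (g t))}.
  by apply: (within_comp (h := snd) cgc) => t _; exact: continuous_snd.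
have Fgc : {within `[a, b], continuous (fun t => F (g t))}.
  by apply: (within_comp (h := fst) cgc) => t _; exact: continuous_fst.
have ia : a <= a <= b by rewrite lexx ltW.
have ib : a <= b <= b by rewrite lexx ltW.
split.
- split.
  + by apply: continuous_compact cgc _; exact: segment_compact.
  + move=> _ [t tab <-]; exists (g t) => //; apply: gY; exists t => //.
  + apply/connected_intervalP; rewrite image_comp.
    by apply: connected_continuous_connected Fgc; exact: segment_connected.
  + move=> f h1 h2 h [s sab cs] [t tab ct] hh.
    rewrite /= !in_itv /= in sab tab.
    have Fs : F (g s) = f by have := congr1 fst cs.
    have Ft : F (g t) = f by have := congr1 fst ct.
    have Hs : H (g s) = h1 by have := congr1 snd cs.
    have Ht : H (g t) = h2 by have := congr1 snd ct.
    have fin r : a <= r <= b -> F (g r) = f -> H (g r) = h ->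
        ((c \o g) @` `[a, b]) (f, h).
      move=> rab Fr Hr; exists r; first by rewrite /= in_itv.
      by rewrite /= [LHS]surjective_pairing Fr Hr.
    have [st|st] := eqVneq s t.
      apply: (fin s) => //; rewrite Hs; apply/le_anti.
      by move: hh; rewrite -Hs -Ht st; rewrite andbC.
    have q0 : q = 0.
      apply: (@mulIf _ (t - s)); first by rewrite subr_eq0 eq_sym.
      by move: Fs Ft; rewrite !Fg // mul0r mulrBr; lra.
    have Fr r : a <= r <= b -> F (g r) = f.
      by move=> rab; rewrite -Fs !Fg // q0 !mul0r.
    have sub u v : a <= u <= b -> a <= v <= b ->
        {within `[u, v], continuous (fun t => H (g t))}.
      move=> uab vab; apply: continuous_subspaceW Hgc => w;
        rewrite /= !in_itv /=; lra.
    have [le_st|lt_ts] := leP s t.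
      have [|r rst Hr] := IVT (v := h) le_st (sub s t sab tab).
        by rewrite Hs Ht ge_min le_max; case/andP: hh => -> ->; rewrite orbT.
      move: rst; rewrite in_itv /= => rst.
      by apply: (fin r) => //; [lra|apply: Fr; lra].
    have [|r rst Hr] := IVT (v := h) (ltW lt_ts) (sub t s tab sab).
      by rewrite Hs Ht ge_min le_max; case/andP: hh => -> ->; rewrite orbT.
    move: rst; rewrite in_itv /= => rst.
    by apply: (fin r) => //; [lra|apply: Fr; lra].
- by exists a => /=; rewrite ?in_itv //= ga.
- by exists b => /=; rewrite ?in_itv //= gb.
- move=> xy _ [t tab <-] /= Ft; rewrite /= in_itv /= in tab.
  have q0 : q != 0.
    by apply: contra_neq xy => q0; rewrite -ga -gb !Fg // q0 !mul0r.
  suff -> : t = a by rewrite ga.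
  by apply: (mulfI q0); move: Ft; rewrite -ga !Fg // => /addrI.
Qed.

Lemma subset_vconvex : vconvex (c @` C).
Proof.
have wc : {within C, continuous c}.
  by apply: within_cts => x /subCB/box_dom; exact: chart_map_continuous.
have cC : compact C by exact: subclosed_compact closedC cB subCB.
apply: vconvex_of_locally_strip_joined.
- apply: compact_closed; first exact: norm_hausdorff.
  exact: continuous_compact.
- exact: connected_continuous_connected.
- move=> _ [x0 Cx0 <-]; have Dx0 := box_dom (subCB Cx0).
  have [W Wx0 [[_ conv] _]] := strongly_convex_nbhs Cx0.
  exists (inv @^-1` W).
    by apply: (chart_inv_continuous (c := c)); [exists x0|rewrite chart_invK].
  move=> _ _ [x Cx <-] + [y Cy <-]; rewrite /= !chart_invK;
    try exact/box_dom/subCB.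
  move=> Wx Wy; have [->|xy] := pselect (x = y).
    exists (segment (c y) (c y)); apply: segment_strip_joined.
    by move=> _ [t _ <-]; rewrite !linaa -surjective_pairing; exists y.
  have [a [b [g [lj gC]]]] := conv x y (conj Cx Wx) (conj Cy Wy) xy.
  exists ((c \o g) @` `[a, b]); apply: line_strip_joined => //.
  by move=> z /gC[].
Qed.

Lemma slice_C b x y z : C x -> C y -> B z -> F x = F z -> F y = F z ->
  A b x <= A b z <= A b y -> C z.
Proof.
move=> Cx Cy Bz xz yz hA.
have CP w : F w = F z -> C w -> (c @` C) (F z, H w).
  by move=> wz Cw; exists w => //; rewrite -wz -surjective_pairing.
have [w Cw cw] : (c @` C) (F z, H z).
  have [h|h] := A_H_between (subCB Cx) (subCB Cy) Bz xz yz hA.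
    by apply: (subset_vconvex _ _ h); exact: CP.
  by apply: (subset_vconvex _ _ h); exact: CP.
suff -> : z = w by [].
by apply: chart_inj; rewrite ?cw //; apply: box_dom => //; exact: subCB.
Qed.

(** * Segments of a branch with ends in [C] *)

Definition seg b x y z := exists2 t, 0 <= t <= 1 &
  F z = lin (F x) (F y) t /\ A b z = lin (A b x) (A b y) t.

Lemma seg_point b x y t : B x -> B y -> 0 <= t <= 1 ->
  exists z, [/\ B z, F z = lin (F x) (F y) t & A b z = lin (A b x) (A b y) t].
Proof.
move=> Bx By t01; apply: A_surj; apply: inQA_lin => //.
  by apply/box_inQA => //; exact: box_dom.
by apply/box_inQA => //; exact: box_dom.
Qed.

Lemma near_A b p r : B p -> 0 < r ->
  \forall x \near p, `|F p - F x| < r /\ `|A b p - A b x| < r.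
Proof.
move=> Bp r0; have Dp := box_dom Bp; apply: filterI.
  apply: near_lt; last by rewrite subrr normr0.
  by apply: cts_norm; apply: ctsD; [cts|apply: ctsN; exact: continuous_F].
apply: near_lt; last by rewrite subrr normr0.
by apply: cts_norm; apply: ctsD; [cts|apply: ctsN; exact: continuous_A].
Qed.

Lemma seg_small b p W : B p -> nbhs p W -> exists2 W', nbhs p W' &
  forall x y z, W' x -> W' y -> B z -> seg b x y z -> W z.
Proof.
move=> Bp /nbhs_ballP[e /= e0 eW]; have [r r0 rP] := A_unif b e0.
exists [set x | `|F p - F x| < r /\ `|A b p - A b x| < r]; first exact: near_A.
move=> x y z [x1 x2] [y1 y2] Bz [t t01 [Fz Az]]; apply: eW; apply: rP => //.
  by rewrite Fz; exact: lin_dist.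
by rewrite Az; exact: lin_dist.
Qed.

(** By [AE] the sum is [k] times the interpolation of the values of F^+ at the ends. It expresses
    that the Gr-segment crosses F = 0 no lower than the Gl-segment. *)
Lemma lin_A_sum b x y t : B x -> B y -> 0 <= t <= 1 -> lin (F x) (F y) t = 0 ->
  0 <= lin (A b x) (A b y) t + lin (A (~~ b) x) (A (~~ b) y) t.
Proof.
move=> Bx By t01 Ft; have := max_lin (F x) (F y) t01.
rewrite Ft maxxx -(ler_pM2l k_gt0) mulr0 => /le_trans; apply.
have ax := AE b (box_dom Bx); have ay := AE b (box_dom By).
rewrite /lin mulrDr mulrCA mulrBr -ax -ay le_eqVlt; apply/orP; left; apply/eqP.
ring.
Qed.

Lemma crosses_other b x y t : B x -> B y -> F x * F y < 0 -> 0 <= t <= 1 ->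
  lin (F x) (F y) t = 0 -> lin (A b x) (A b y) t < 0 ->
  crosses_well (~~ b) x y.
Proof.
move=> Bx By fxy t01 Ft At; right => s s01 Fs.
have xy : F x != F y.
  by apply: contraTneq fxy => ->; rewrite -leNgt -expr2 sqr_ge0.
have -> : s = t by apply: (lin_eq0_uniq xy); rewrite Fs Ft.
have := lin_A_sum b Bx By t01 Ft; lra.
Qed.

Lemma crosses_wellPn b x y : ~ crosses_well b x y -> F x * F y < 0 /\
  exists2 t, 0 <= t <= 1 & lin (F x) (F y) t = 0 /\ lin (A b x) (A b y) t < 0.
Proof.
move=> ncw; have [h|h] := ltP (F x * F y) 0; last by case: ncw; left.
split=> //; apply: contrapT => none; apply: ncw; right => t t01 Ft.
by rewrite leNgt; apply/negP => At; apply: none; exists t.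
Qed.

Lemma crosses_some x y : B x -> B y -> exists b, crosses_well b x y.
Proof.
move=> Bx By; have [?|/crosses_wellPn[fxy [t t01 [Ft At]]]] :=
  pselect (crosses_well true x y); first by exists true.
by exists false; exact: crosses_other fxy t01 Ft At.
Qed.

Lemma line_seg_exists b x y : B x -> B y -> x <> y -> crosses_well b x y ->
  exists g, [/\ line_joining S B x y 0 1 g,
    forall z, (g @` `[0, 1]) z -> B z /\ seg b x y z &
    forall z, B z -> seg b x y z -> (g @` `[0, 1]) z].
Proof.
move=> Bx By xy cw; have [g [lj gP]] := line_exists Bx By xy cw.
exists g; split=> // [_ [t t01 <-]|z Bz [t t01 [Fz Az]]].
  rewrite /= in_itv /= in t01; have [Bt Ft At] := gP t t01.
  by split=> //; exists t.
have [Bt Ft At] := gP t t01; exists t; first by rewrite /= in_itv.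
by apply: (@A_inj b); rewrite ?Ft ?At.
Qed.

Lemma seg_xx b x z : B x -> B z -> seg b x x z -> z = x.
Proof.
by move=> Bx Bz [t _ [Fz Az]]; apply: (@A_inj b); rewrite ?Fz ?Az ?linaa.
Qed.

Lemma well_crossing_seg_sub p : C p -> exists2 W, nbhs p W &
  forall b x y z, C x -> W x -> C y -> W y -> crosses_well b x y ->
    B z -> seg b x y z -> C z.
Proof.
move=> Cp; have Bp := subCB Cp.
have [W0 W0p [_ [_ strong]]] := strongly_convex_nbhs Cp.
have [W1 W1p sm1] := seg_small true Bp W0p.
have [W2 W2p sm2] := seg_small false Bp W0p.
exists (W0 `&` W1 `&` W2); first by do !apply: filterI.
move=> b x y z Cx [[W0x W1x] W2x] Cy [[W0y W1y] W2y] cw Bz sz.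
have [xy|xy] := pselect (x = y).
  by rewrite -xy in sz; rewrite (seg_xx (subCB Cx) Bz sz).
have [g [lj gs sg]] := line_seg_exists (subCB Cx) (subCB Cy) xy cw.
have [] // := strong x y (conj Cx W0x) (conj Cy W0y) xy 0 1 g lj _ z (sg z Bz sz).
move=> w /gs[Bw sw]; split=> //.
by case: (b) sw => sw; [exact: sm1 sw|exact: sm2 sw].
Qed.

Definition locally_seg_convex b := forall p, C p -> exists2 W, nbhs p W &
  forall x y z, C x -> W x -> C y -> W y -> B z -> seg b x y z -> C z.

Lemma seg_convex b x y z : locally_seg_convex b -> C x -> C y -> B z ->
  seg b x y z -> C z.
Proof.
move=> lC Cx Cy Bz [t t01 [Fz Az]].
pose P x : R * R := (F x, A b x).
have wP : {within C, continuous P}.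
  apply: within_cts => w /subCB/box_dom Dw.
  by apply: cts_pair; [exact: continuous_F|exact: continuous_A].
have segE u v s : 0 <= s <= 1 -> C u -> C v ->
    exists2 w, B w & P w = (lin (F u) (F v) s, lin (A b u) (A b v) s).
  move=> s01 Cu Cv; have [w [Bw Fw Aw]] := seg_point b (subCB Cu) (subCB Cv) s01.
  by exists w => //; rewrite /P Fw Aw.
have cC : compact C by exact: subclosed_compact closedC cB subCB.
have TN : forall u v, (P @` C) u -> (P @` C) v -> segment u v `<=` P @` C.
  apply: tietze_nakajima.
  - exact: continuous_compact.
  - exact: connected_continuous_connected.
  - move=> _ [p Cp <-]; have [W /nbhs_ballP[e /= e0 eW] WC] := lC p Cp.
    have [r r0 rP] := A_unif b e0.
    exists [set q | `|F p - q.1| < r /\ `|A b p - q.2| < r].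
      apply: filterI.
        apply: (near_lt (f := fun q : R * R => `|F p - q.1|)); first by cts.
        by rewrite subrr normr0.
      apply: (near_lt (f := fun q : R * R => `|A b p - q.2|)); first by cts.
      by rewrite subrr normr0.
    move=> _ _ [u Cu <-] [/= u1 u2] [v Cv <-] [/= v1 v2] _ [s s01 <-] /=.
    have {}s01 : 0 <= s <= 1 by move: s01; rewrite /= in_itv.
    have [w Bw Pw] := segE u v s s01 Cu Cv; exists w => //.
    apply: (WC u v) => //.
    + by apply: eW; apply: rP => //; exact: subCB.
    + by apply: eW; apply: rP => //; exact: subCB.
    + by exists s => //; case: Pw.
have [w Cw [Fw Aw]] : (P @` C) (P z).
  apply: (TN (P x) (P y)); [by exists x|by exists y|].
  by exists t; [rewrite /= in_itv|rewrite /P Fz Az].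
by rewrite (_ : z = w) //; apply: (@A_inj b) => //; exact: subCB.
Qed.

Lemma locally_seg_convex_focus b : C O -> locally_seg_convex b.
Proof.
move=> CO p Cp; have [W Wp WC] := well_crossing_seg_sub Cp.
have [W' W'p sm] := seg_small b (subCB Cp) Wp.
exists (W `&` W'); first exact: filterI.
move=> x y z Cx [Wx W'x] Cy [Wy W'y] Bz sz.
have [cw|/crosses_wellPn[fxy [t t01 [Ft At]]]] := pselect (crosses_well b x y).
  exact: WC cw Bz sz.
have Bx := subCB Cx; have By := subCB Cy.
have [w [Bw Fw Aw]] := seg_point b Bx By t01.
have Ww : W w by apply: (sm x y w) => //; exists t.
have Cw : C w.
  have cw := crosses_other Bx By fxy t01 Ft At.
  have [w' [Bw' Fw' Aw']] := seg_point (~~ b) Bx By t01.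
  have Cw' : C w' by apply: (WC (~~ b) x y w') => //; exists t.
  (* Over F = 0 the two branches are opposite, so [lin_A_sum] places [w] between [w'] and O in the
     fibre. *)
  apply: (@slice_C b w' O) => //; rewrite ?Fw ?Fw' ?FO //;
    rewrite AO Aw (ltW At) andbT.
  have := AE b (box_dom Bw'); rewrite Fw' Ft maxxx mulr0 => s0.
  have := lin_A_sum b Bx By t01 Ft.
  by rewrite -Aw'; lra.
have Fw0 : F w = 0 by rewrite Fw Ft.
(* Cut at [w], where F vanishes, the segment gives two pieces on each of which F keeps its sign;
   both cross well. *)
case: sz => s s01 [Fz Az]; have [st|ts] := leP s t.
  have [r r01 rs] : exists2 r, 0 <= r <= 1 & lin 0 t r = s.
    by apply: lin_between; case/andP: s01 => ->.
  apply: (WC b x w) => //; first by left; rewrite Fw0 mulr0.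
  exists r => //; rewrite Fw Aw Fz Az -rs !lin_lin !lin0.
  by [].
have [r r01 rs] : exists2 r, 0 <= r <= 1 & lin t 1 r = s.
  by apply: lin_between; case/andP: s01 => _ ->; rewrite ltW.
apply: (WC b w y) => //; first by left; rewrite Fw0 mul0r.
by exists r => //; rewrite Fw Aw Fz Az -rs !lin_lin !lin1.
Qed.

(** Points of [C] over F = 0 on both sides of O would put O in [C], by [slice_C]. *)
Lemma one_sided : ~ C O -> exists b, forall p, C p -> F p = 0 -> 0 < A b p.
Proof.
move=> nCO; have [[p Cp Fp]|none] := pselect (exists2 p, C p & F p = 0);
  last first.
  by exists true => p Cp Fp; case: none; exists p.
have [b Ap] : exists b, 0 < A b p.
  have := AE true (box_dom (subCB Cp)); rewrite Fp maxxx mulr0 => s0.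
  have [a0|a0|a0] := ltgtP (A true p) 0.
  - by exists false; move: s0 a0 => /=; lra.
  - by exists true.
  - case: nCO; rewrite -(_ : p = O) //; apply: (@A_inj true) => //.
    + exact: subCB.
    + exact: box_O.
    + by rewrite FO.
    + by rewrite AO.
exists b => q Cq Fq; rewrite ltNge; apply/negP => Aq; apply: nCO.
by apply: (slice_C (b := b) Cq Cp box_O); rewrite ?FO // AO Aq ltW.
Qed.

(** Near a point over F = 0, [A b] stays positive along short segments; near any other point of [C],
    F keeps its sign. So all short segments of branch [b] cross well. *)
Lemma locally_seg_convex_one_sided b :
  (forall p, C p -> F p = 0 -> 0 < A b p) -> locally_seg_convex b.
Proof.
move=> pos p Cp; have [W Wp WC] := well_crossing_seg_sub Cp.
have Dp := box_dom (subCB Cp).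
suff [W' W'p cw] : exists2 W', nbhs p W' &
    forall x y, W' x -> W' y -> crosses_well b x y.
  exists (W `&` W'); first exact: filterI.
  move=> x y z Cx [Wx W'x] Cy [Wy W'y] Bz sz.
  by apply: (WC b x y) => //; exact: cw.
have [Fp|Fp|Fp] := ltgtP (F p) 0.
- exists [set x | F x < 0]; first exact: near_lt (continuous_F Dp) Fp.
  by move=> x y /= x0 y0; left; rewrite mulr_le0 // ltW.
- exists [set x | 0 < F x]; first exact: near_gt (continuous_F Dp) Fp.
  by move=> x y /= x0 y0; left; rewrite mulr_ge0 // ltW.
- exists [set x | 0 < A b x];
  first exact: near_gt (continuous_A Dp) (pos p Cp Fp).
  by move=> x y /= x0 y0; right => t t01 _; rewrite lin_ge // ltW.
Qed.

Theorem subset_convex : convex_in S B C.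
Proof.
split=> // x y Cx Cy xy; have Bx := subCB Cx; have By := subCB Cy.
suff [b [lC cw]] : exists b, locally_seg_convex b /\ crosses_well b x y.
  have [g [lj gs _]] := line_seg_exists Bx By xy cw.
  exists 0, 1, g; split=> // z /gs[Bz sz].
  exact: seg_convex lC Cx Cy Bz sz.
have [CO|nCO] := pselect (C O).
  have [b cw] := crosses_some Bx By; exists b; split=> //.
  exact: locally_seg_convex_focus.
have [b pos] := one_sided nCO; have lC := locally_seg_convex_one_sided pos.
(* The branch is imposed by [C] here. The crossing point is in [C] by the convexity already obtained
   for segments, hence on the good side of O, and this is what makes the segment a straight line. *)
exists b; split=> //; right => t t01 Ft.
have [w [Bw Fw Aw]] := seg_point b Bx By t01.
by rewrite -Aw ltW // pos ?Fw //; apply: (seg_convex lC Cx Cy Bw); exists t.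
Qed.

(** Every straight line is a segment of some branch, and [C] is convex for the segments of both
    branches once it contains O. *)
Theorem subset_strongly_convex : C O -> strongly_convex_in S B B C.
Proof.
move=> CO; split; first exact: subset_convex.
split=> // x y Cx Cy xy a b g [ab sl ga gb] gB _ [u uab <-].
have [afF [e afA]] := straight_line_model ab sl.
apply: (seg_convex (locally_seg_convex_focus e CO) Cx Cy).
  by apply: gB; exists u.
rewrite /= in_itv /= in uab; have [t t01 <-] := lin_between uab.
exists t => //; rewrite -ga -gb.
split; first exact: affine_on_lin afF t01 (ltW ab).
exact: affine_on_lin afA t01 (ltW ab).
Qed.

End LocallyConvexSubset.
End FocusBox.

Theorem proposition8p4 (R : realType) (M : metricType R)
    (S : singular_affine_surface M) (O : M) (B C : set M)
    (boxB : focus_box S O B) (subCB : C `<=` B)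
    (closedC : closed C) (connectedC : connected C)
    (slcC : strongly_locally_convex S B C) :
  convex_in S B C /\ (C O -> strongly_convex_in S B B C).
Proof.
have [cB conB focB [c [Gl [Gr [k [d [d' [mc d0 d'0 eB]]]]]]]] := boxB.
rewrite {boxB}eB in cB conB focB subCB slcC *; split.
  exact: (subset_convex mc d0 d'0 cB conB focB).
exact: (subset_strongly_convex mc d0 d'0 cB conB focB).
Qed.
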